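(* Let $n$ be a positive integer and let $W=W(B_n)$ be the group of signed permutations, acting on $R=\mathbf{C}[x_1,x_2,\dots,x_n,y_1,y_2,\dots,y_n]$ by simultaneous sign-changes and permutations of the two sets of variables. Let $I_W$ be the ideal of $R$ generated by the positive-degree $W$-invariant polynomials, let $R_W=R/I_W$ be the quotient ring, and put $\epsilon(W(B_n))=\dim_{\mathbf{C}}(R_W)-(2n+1)^n$. Then $$\epsilon(W(B_n)) \geq \begin{cases} n(n-4)/4 & \text{if } n\equiv 0 \pmod 4,\\ n(n-6)/4 & \text{if } n\equiv 2 \pmod 4,\\ (n-1)(n-3)/4 & \text{if } n \text{ is odd.}\end{cases}$$ Moreover, $\epsilon(W(B_4))\geq 1$ and $\epsilon(W(B_6))\geq 3$.
   Context: $W(B_n)$ is the group of $n\times n$ signed permutation matrices (exactly one nonzero entry, equal to $\pm1$, in each row and column). It acts on $R$ by algebra automorphisms, diagonally on the two sets of variables: if $w\in W(B_n)$ sends the $i$th basis vector to $\pm$ the $j$th basis vector, then $w$ sends $x_i\mapsto \pm x_j$ and $y_i\mapsto \pm y_j$ with the same sign. ''Positive-degree $W$-invariant polynomials'' means $W$-invariant elements of $R$ with zero constant term. *)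

(* Defs.v *)
From HB Require Import structures.
From mathcomp Require Import all_boot all_order all_algebra.
From mathcomp Require Import generic_quotient ring_quotient.
From mathcomp Require Import complex mpoly.
From mathcomp Require Import boolp reals.

Set Implicit Arguments.
Unset Strict Implicit.
Unset Printing Implicit Defensive.

Import GRing.Theory.

Local Open Scope ring_scope.
Local Open Scope quotient_scope.

Section Dimension.
Variable F : fieldType.

(* [Vector.axiom d V] is the type of linear bijections V -> F^d; the value is *)
(* 0 when V is infinite-dimensional.                                          *)
Definition lmod_dim (V : lmodType F) : nat :=
  if pselect (exists d, inhabited (Vector.axiom d V)) is left h
  then sval (cid h) else 0%N.

Lemma vector_axiom_inj (V : lmodType F) d e :
  Vector.axiom d V -> Vector.axiom e V -> d = e.
Proof.
have le m n (f : V -> 'rV[F]_m) (g : V -> 'rV[F]_n) :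
    linear f -> bijective f -> linear g -> bijective g -> (m <= n)%N.
  move=> lf [f' fK f'K] lg /bij_inj ginj.
  have lh : linear (g \o f').
    move=> a u v /=; rewrite -lg; congr g.
    by rewrite -[RHS]fK lf !f'K.
  pose h : {linear 'rV[F]_m -> 'rV[F]_n} :=
    HB.pack (g \o f') (GRing.isLinear.Build F _ _ _ (g \o f') lh).
  have : row_free (lin1_mx h).
    rewrite -kermx_eq0; apply/eqP/row_matrixP => i; rewrite row0.
    have : row i (kermx (lin1_mx h)) *m lin1_mx h = 0.
      by rewrite -row_mul mulmx_ker row0.
    rewrite mul_rV_lin1 -(linear0 h) /= => /ginj E.
    by rewrite -[LHS]f'K E f'K.
  by rewrite /row_free => /eqP <-; apply: rank_leq_col.
move=> [f lf bf] [g lg bg]; apply/eqP.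
by rewrite eqn_leq (le _ _ _ _ lf bf lg bg) (le _ _ _ _ lg bg lf bf).
Qed.

Lemma lmod_dimE (V : lmodType F) d : Vector.axiom d V -> lmod_dim V = d.
Proof.
move=> ax; rewrite /lmod_dim; case: pselect => [h|[]]; last first.
  by exists d; constructor.
by case: (cid h) => e [ax'] /=; apply: vector_axiom_inj ax' ax.
Qed.

End Dimension.

Definition gen_ideal (R : comNzRingType) (G : R -> Prop) : {pred R} :=
  fun p => `[< exists s : seq (R * R),
    (forall u, u \in s -> G u.2) /\ p = \sum_(u <- s) u.1 * u.2 >].

Section SignedPermutations.
Variables (F : fieldType) (n : nat).

Definition signed_perm_mx : {pred 'M[F]_n} := fun w =>
  [&& [forall i, forall j, w i j \in [:: 0; 1; -1]],
      [forall i, #|[set j | w i j != 0]| == 1%N]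
    & [forall j, #|[set i | w i j != 0]| == 1%N]].

(* The polynomial ring in x_i = 'X_(lshift n i) and y_i = 'X_(rshift n i).    *)
(* A matrix w acts on column vectors, sending the i-th basis vector to        *)
(* \sum_j w j i e_j, and it substitutes \sum_j w j i x_j for x_i and          *)
(* \sum_j w j i y_j for y_i.                                                  *)
Definition diag_act (w : 'M[F]_n) (p : {mpoly F[n + n]}) : {mpoly F[n + n]} :=
  p \mPo [tuple match split k with
                | inl i => \sum_j w j i *: 'X_(lshift n j)
                | inr i => \sum_j w j i *: 'X_(rshift n j)
                end | k < n + n].

Definition W_invariant (p : {mpoly F[n + n]}) : Prop :=
  forall w, w \in signed_perm_mx -> diag_act w p = p.

Definition pos_W_invariant (p : {mpoly F[n + n]}) : Prop :=
  W_invariant p /\ p@_0%MM = 0.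

Definition coinv_ideal : {pred {mpoly F[n + n]}} := gen_ideal pos_W_invariant.

Lemma coinv_ideal_closed : idealr_closed coinv_ideal.
Proof.
split.
- by apply/asboolP; exists [::]; split=> //; rewrite big_nil.
- apply/negP => /asboolP[s [Gs /(congr1 (mcoeff 0%MM))]].
  rewrite rmorph1 raddf_sum /= big_seq big1 => [|u /Gs[_ u0]].
    by move/eqP; rewrite oner_eq0.
  by rewrite rmorphM /= u0 mulr0.
- move=> a p q /asboolP[s [Gs ->]] /asboolP[t [Gt ->]]; apply/asboolP.
  exists ([seq (a * u.1, u.2) | u <- s] ++ t); split.
    move=> u; rewrite mem_cat => /orP[/mapP[v vs ->]|]; last exact: Gt.
    exact: (Gs v vs).
  rewrite big_cat big_map /= mulr_sumr; congr (_ + _).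
  by apply: eq_bigr => u _; rewrite mulrA.
Qed.

HB.instance Definition _ :=
  isIdealr.Build {mpoly F[n + n]} coinv_ideal coinv_ideal_closed.

Definition coinv_ring := {ideal_quot coinv_ideal}.

HB.instance Definition _ := GRing.ComNzRing.on coinv_ring.

Definition coinv_const (c : F) : coinv_ring := \pi_coinv_ring (c%:MP).

Definition coinv_scale (c : F) (x : coinv_ring) : coinv_ring :=
  coinv_const c * x.

Lemma coinv_scaleA a b x :
  coinv_scale a (coinv_scale b x) = coinv_scale (a * b) x.
Proof. by rewrite /coinv_scale mulrA /coinv_const mpolyCM rmorphM. Qed.

Lemma coinv_scale1 : left_id 1 coinv_scale.
Proof. by move=> x; rewrite /coinv_scale /coinv_const mpolyC1 rmorph1 mul1r. Qed.

Lemma coinv_scaleDr : right_distributive coinv_scale +%R.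
Proof. by move=> a x y; rewrite /coinv_scale mulrDr. Qed.

Lemma coinv_scaleDl x : {morph coinv_scale^~ x : a b / a + b}.
Proof.
by move=> a b; rewrite /coinv_scale /coinv_const mpolyCD rmorphD mulrDl.
Qed.

HB.instance Definition _ := GRing.Zmodule_isLmodule.Build F coinv_ring
  coinv_scaleA coinv_scale1 coinv_scaleDr coinv_scaleDl.

Lemma coinv_scaleAl a (x y : coinv_ring) : a *: (x * y) = a *: x * y.
Proof. by rewrite /GRing.scale /= /coinv_scale mulrA. Qed.

HB.instance Definition _ :=
  GRing.Lmodule_isLalgebra.Build F coinv_ring coinv_scaleAl.

Lemma pi_coinv_ringZ (c : F) (p : {mpoly F[n + n]}) :
  \pi_coinv_ring (c *: p) = c *: (\pi_coinv_ring p : coinv_ring) :> coinv_ring.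
Proof. by rewrite -mul_mpolyC rmorphM. Qed.

Definition epsilon : int := (lmod_dim coinv_ring)%:Z - ((2 * n + 1) ^ n)%N%:Z.

End SignedPermutations.

(* Main.v *)
From HB Require Import structures.
Require Import Defs.
From mathcomp Require Import all_boot all_order all_algebra all_fingroup.
From mathcomp Require Import ring_quotient generic_quotient ssrcomplements mpoly complex boolp reals.
From mathcomp Require Import ring lra zify.

Set Implicit Arguments.
Unset Strict Implicit.
Unset Printing Implicit Defensive.

Import Order.TTheory GRing.Theory Num.Theory.
Local Open Scope ring_scope.

(** Let P = F[x, y] and R = P^(tensor n), with W acting through the sign changes
    (x, y) -> (-x, -y) of the factors and the permutations of the factors.

    The quotient of dimension (2n+1)^n.  On V = F^(2n+1) there are operators X
    (raising) and Y (lowering) with YX - XY = 1 - (2n+1) S, S being the parity: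
    V is the finite-dimensional representation of the rational Cherednik algebra
    of Z/2 at parameter n + 1/2.  Its odd part has dimension n, so that up to a
    scalar there is a unique vector [vac] of V^(tensor n) that is odd in every
    factor and alternating.  Let x_i and y_i act on the i-th factor.  Products of
    these operators obey the relations of R up to terms of lower degree, because
    the commutators only involve parities, and they generate all of V^(tensor n)
    from [vac].  Writing [Phi] p for the polynomial p applied to [vac] (X's to the
    left of Y's), a power sum of positive even degree sends [vac] to a multiple
    of itself, that is, into a lower degree, and these power sums generate the
    ideal ([coinv_ideal_ind]).  Hence R_W maps onto the associated graded space of
    V^(tensor n), which already gives dim R_W >= (2n+1)^n.

    The excess.  Let chi be the character of W that is trivial on permutations
    and -1 on each sign change.  Up to lower degrees, the polynomials that
    transform by chi map [vac] to vectors that are even in every factor and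
    alternating; these form the n-th exterior power of the even part of V, of
    dimension n + 1, and they are all reached by polynomials of degree n
    ([even_alternating_filt]).  A chi-semi-invariant polynomial of degree
    larger than n is therefore sent into a lower degree, so chi-semi-invariants
    of degree larger than n that are linearly independent in R_W add to
    (2n+1)^n ([lmod_dim_coinv_ring]).

    Such semi-invariants are detected by polarization.  The chi-semi-invariants
    are the symmetric tensors of degree n in the odd part of P, and a linear form
    on them that kills the ideal is a polynomial G of degree n in the coefficients
    of an odd power series f, such that G does not change when f is multiplied by
    an even unit with constant term 1.  Thus G is an invariant of the germ of
    curve f = 0.  With f = a x + b y + (cubic) + (quintic) + ... and the tangent
    vector u = (b, -a), examples are a, b, the cubic form at u, of degree 4, and
    two polynomials of degree 7 that express the fifth-order Taylor coefficient
    of the curve ([jet_x], [jet_y]).  Products of these are dual to explicit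
    families of semi-invariants ([dual_form_coef]), and counting those gives

      (n-3) + (n-5) + (n-7) + ...

    where the summands are positive, except that for n = 2 modulo 4, n > 2, the
    last summand 1 is missing.  The bounds of the theorem follow. *)


(** * Bases of a module spanned by a finite sequence *)

Section Bases.
Variables (F : fieldType) (V : lmodType F).
Implicit Types (b s t : seq V).

Definition lin_comb b (c : nat -> F) : V := \sum_(i < size b) c i *: b`_i.
Definition spanned b (v : V) : Prop := exists c, v = lin_comb b c.
Definition indep b : Prop :=
  forall c, lin_comb b c = 0 -> forall i, (i < size b)%N -> c i = 0.

Lemma lin_comb_rcons b v c :
  lin_comb (rcons b v) c = lin_comb b c + c (size b) *: v.
Proof.
rewrite /lin_comb size_rcons big_ord_recr /= nth_rcons ltnn eqxx.
by congr (_ + _); apply: eq_bigr => i _; rewrite nth_rcons ltn_ord.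
Qed.

Lemma spanned_rconsl b v u : spanned b u -> spanned (rcons b v) u.
Proof.
move=> [c ->]; exists (fun i => if i == size b then 0 else c i).
rewrite lin_comb_rcons eqxx scale0r addr0.
by apply: eq_bigr => i _; rewrite ltn_eqF.
Qed.

Lemma spanned_rconsr b v : spanned (rcons b v) v.
Proof.
exists (fun i => (i == size b)%:R).
rewrite lin_comb_rcons eqxx scale1r /lin_comb big1 ?add0r // => i _.
by rewrite ltn_eqF // scale0r.
Qed.

Lemma indep_rcons b v : indep b -> ~ spanned b v -> indep (rcons b v).
Proof.
move=> fb nv c; rewrite lin_comb_rcons => e.
have cb0 : c (size b) = 0.
  apply: contrapT => /eqP cb; apply: nv; exists (fun i => - (c i / c (size b))).
  have -> : lin_comb b (fun i => - (c i / c (size b)))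
            = - (c (size b))^-1 *: lin_comb b c.
    rewrite /lin_comb scaler_sumr; apply: eq_bigr => i _.
    by rewrite scalerA mulNr mulrC.
  move/eqP: e; rewrite addr_eq0 => /eqP ->.
  by rewrite scalerN scaleNr opprK scalerA mulVf // scale1r.
move: e; rewrite cb0 scale0r addr0 => /fb c0 i.
by rewrite size_rcons ltnS leq_eqVlt => /predU1P[->|/c0].
Qed.

(** Exchange lemma: the new basis elements are taken among the given spanning
    elements, which is what keeps a basis of the quotient ring homogeneous. *)
Lemma indep_extend (T : eqType) (f : T -> V) (l s : seq T) :
  indep (map f l) ->
  exists r, [/\ {subset r <= s}, indep (map f (l ++ r))
    & forall x, x \in s -> spanned (map f (l ++ r)) (f x)].
Proof.
move=> fl; elim/last_ind: s => [|s x [r [rs fr sr]]].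
  by exists [::]; rewrite cats0.
have [sx|nx] := pselect (spanned (map f (l ++ r)) (f x)).
  exists r; split=> // [y /rs ys|y]; first by rewrite mem_rcons inE ys orbT.
  by rewrite mem_rcons inE => /predU1P[->|/sr].
exists (rcons r x); rewrite -rcons_cat map_rcons; split=> [y||y].
- by rewrite !mem_rcons !inE => /predU1P[->|/rs ->]; rewrite ?eqxx ?orbT.
- exact: indep_rcons.
- rewrite mem_rcons inE => /predU1P[->|/sr]; first exact: spanned_rconsr.
  exact: spanned_rconsl.
Qed.

Lemma basis_vector_axiom b :
  indep b -> (forall v, spanned b v) -> Vector.axiom (size b) V.
Proof.
move=> fb sb.
pose g (w : 'rV[F]_(size b)) : V := \sum_(i < size b) w 0 i *: b`_i.
have gl : linear g.
  move=> a u v; rewrite /g scaler_sumr -big_split /=; apply: eq_bigr => i _.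
  by rewrite !mxE scalerDl scalerA.
have gi : injective g.
  move=> u v e; apply/rowP => i; apply/eqP; rewrite -subr_eq0; apply/eqP.
  have: lin_comb b (fun j => if insub j is Some k then u 0 k - v 0 k else 0) = 0.
    rewrite /lin_comb -[RHS](subrr (g v)) -{1}e /g -sumrB; apply: eq_bigr => j _.
    by rewrite valK scalerBl.
  by move/fb/(_ i (ltn_ord i)); rewrite valK.
have gs v : exists w, g w == v.
  have [c ->] := sb v; exists (\row_i c i); apply/eqP.
  by rewrite /g; apply: eq_bigr => i _; rewrite mxE.
pose f v := xchoose (gs v).
have fK : cancel f g by move=> v; apply/eqP; apply: xchooseP (gs v).
exists f; last by exists g => // w; apply: gi; rewrite fK.
by move=> a u v; apply: gi; rewrite fK gl !fK.
Qed.

End Bases.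

(** * Polynomials as combinations of monomials, and the power sum ideal *)

Section LinearExtension.
Variables (R : comNzRingType) (N : nat) (V : lmodType R) (g : 'X_{1..N} -> V).

Definition lin_ext (p : {mpoly R[N]}) : V := \sum_(m <- msupp p) p@_m *: g m.

Lemma lin_extwE k p : (msize p <= k)%N ->
  lin_ext p = \sum_(m : 'X_{1..N < k}) p@_m *: g m.
Proof.
move=> pk; rewrite /lin_ext (big_mksub 'X_{1..N < k}) ?msupp_uniq //=.
  by rewrite big_rmcond //= => m /memN_msupp_eq0 ->; rewrite scale0r.
by move=> m /msize_mdeg_lt /leq_trans; apply.
Qed.

Lemma lin_ext_is_linear : linear lin_ext.
Proof.
move=> a p q; set k := maxn (msize (a *: p + q)) (maxn (msize p) (msize q)).
rewrite !(@lin_extwE k) ?leq_max ?leqnn ?orbT // scaler_sumr -big_split /=.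
by apply: eq_bigr => m _; rewrite mcoeffD mcoeffZ scalerDl scalerA.
Qed.

HB.instance Definition _ :=
  GRing.isLinear.Build R {mpoly R[N]} V _ lin_ext lin_ext_is_linear.

Lemma lin_extX m : lin_ext 'X_[m] = g m.
Proof. by rewrite /lin_ext msuppX big_seq1 mcoeffX eqxx scale1r. Qed.

End LinearExtension.

Section Monomials.
Variables (F : numFieldType) (n : nat).
Local Notation R := {mpoly F[n + n]}.
Implicit Types (mu : 'I_n -> nat * nat) (nu : nat * nat) (m : 'X_{1..n + n}).

Definition xmon nu (i : 'I_n) : R :=
  'X_(lshift n i) ^+ nu.1 * 'X_(rshift n i) ^+ nu.2.
Definition mono mu : R := \prod_i xmon (mu i) i.
(** A monomial of R is a tensor of n monomials of F[x, y]; the i-th one is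
    recorded by its pair of exponents. *)
Definition rows m (i : 'I_n) : nat * nat := (m (lshift n i), m (rshift n i)).
Definition addrow mu nu (i l : 'I_n) : nat * nat :=
  if l == i then ((mu l).1 + nu.1, (mu l).2 + nu.2)%N else mu l.

Lemma eq_mono mu mu' : mu =1 mu' -> mono mu = mono mu'.
Proof. by move=> e; apply: eq_bigr => i _; rewrite e. Qed.

Lemma mpolyX_rows m : 'X_[m] = mono (rows m).
Proof. by rewrite mpolyXE_id big_split_ord /= -big_split. Qed.

Definition mexp mu : 'X_{1..n + n} :=
  [multinom match split k with inl i => (mu i).1 | inr i => (mu i).2 end
  | k < n + n].

Lemma rows_mexp mu : rows (mexp mu) =1 mu.
Proof.
move=> i; rewrite /rows !mnmE; case: splitP => j /= e; last first.
  by have := ltn_ord i; rewrite e ltnNge leq_addr.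
case: splitP => k /= e'; first by have := ltn_ord k; rewrite -e' ltnNge leq_addr.
have -> : j = i by apply: val_inj.
have -> : k = i by apply: val_inj; move/addnI: e'.
by case: (mu i).
Qed.

Lemma mono_mexp mu : mono mu = 'X_[mexp mu].
Proof. by rewrite mpolyX_rows; apply/esym/eq_mono/rows_mexp. Qed.

Lemma mdeg_mexp mu : mdeg (mexp mu) = (\sum_i ((mu i).1 + (mu i).2))%N.
Proof.
rewrite mdegE big_split_ord /= -big_split /=; apply: eq_bigr => i _.
by have /= := rows_mexp mu i; rewrite /rows; case: (mu i) => ? ? [-> ->].
Qed.

Lemma mono_addrow mu nu i : mono (addrow mu nu i) = mono mu * xmon nu i.
Proof.
rewrite /mono (bigD1 i) //= [in RHS](bigD1 i) //= [RHS]mulrAC; congr (_ * _).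
  by rewrite /addrow eqxx /xmon /= !exprD mulrACA.
by apply: eq_bigr => j /negPf ji; rewrite /addrow ji.
Qed.

(** The polarized power sums. *)
Definition psum nu : R := \sum_i xmon nu i.

Lemma mono_psum mu nu : mono mu * psum nu = \sum_i mono (addrow mu nu i).
Proof. by rewrite mulr_sumr; apply: eq_bigr => i _; rewrite mono_addrow. Qed.

Definition even_pair nu := ~~ odd (nu.1 + nu.2).

Definition orbit_sum mu : R := \sum_(s : 'S_n) mono (mu \o s).

Lemma orbit_sum_perm mu (t : 'S_n) : orbit_sum (mu \o t) = orbit_sum mu.
Proof.
rewrite /orbit_sum (reindex_inj (mulIg t^-1)%g) /=; apply: eq_bigr => s _.
by apply: eq_mono => i; rewrite /= permM permKV.
Qed.

(** Multiplying a symmetrized monomial by a power sum inserts the exponent of the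
    power sum in every possible row; the rows that were empty produce the
    symmetrized monomial with one more nonempty row. *)
Lemma orbit_sum_psum mu nu :
  orbit_sum mu * psum nu = \sum_j orbit_sum (addrow mu nu j).
Proof.
rewrite /orbit_sum exchange_big mulr_suml; apply: eq_bigr => s _.
rewrite mono_psum (reindex_inj (@perm_inj _ s^-1)%g) /=; apply: eq_bigr => j _.
apply: eq_mono => i; rewrite /addrow /=.
by rewrite -(inj_eq (@perm_inj _ s)) permKV.
Qed.

(** The ideal is generated by the power sums of positive even degree (a form of
    Weyl's polarization theorem).  It is stated as an induction principle,
    for predicates that are closed under sums. *)
Section PowerSumIdeal.
Variable P : R -> Prop.
Hypotheses (P0 : P 0) (PD : forall p q, P p -> P q -> P (p + q)).
Hypothesis Pgen : forall c mu nu, even_pair nu -> nu != (0, 0)%N ->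
  P (c *: (mono mu * psum nu)).

Let stable p := forall q, P (q * p).

Let stableD p q : stable p -> stable q -> stable (p + q).
Proof. by move=> sp sq r; rewrite mulrDr; apply: PD. Qed.

Let stableM p q : stable p -> stable (q * p).
Proof. by move=> sp r; rewrite mulrA. Qed.

Let stable_sum (I : Type) (r : seq I) (Q : pred I) (f : I -> R) :
  (forall i, Q i -> stable (f i)) -> stable (\sum_(i <- r | Q i) f i).
Proof.
by move=> sf; elim/big_ind: _ => //; move=> q; rewrite mulr0.
Qed.

Let stable_psum nu : even_pair nu -> nu != (0, 0)%N -> stable (psum nu).
Proof.
move=> e z q; rewrite [q]mpolyE mulr_suml.
elim/big_ind: _ => // m _; rewrite -scalerAl mpolyX_rows; exact: Pgen.
Qed.

Let supp mu := [set i | mu i != (0, 0)%N].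

(** By induction on the number of nonempty rows of [mu]: split off one of them as
    a power sum and use [orbit_sum_psum]. *)
Let stable_orbit_sum mu : (forall i, even_pair (mu i)) ->
  (exists i, mu i != (0, 0)%N) -> stable (orbit_sum mu).
Proof.
move: {2}#|supp mu| (leqnn #|supp mu|) => r.
elim: r mu => [|r IH] mu le_r ev [j0 nz].
  by move: le_r; rewrite leqNgt (cardD1 j0) inE nz.
have [mu' mu'E] : {mu' | forall l, mu' l = if l == j0 then (0, 0)%N else mu l}.
  by exists (fun l => if l == j0 then (0, 0)%N else mu l).
have ev' l : even_pair (mu' l) by rewrite mu'E; case: eqP.
have supp' : supp mu' = supp mu :\ j0.
  by apply/setP => l; rewrite !inE mu'E; case: (l == j0); rewrite ?eqxx.
have := orbit_sum_psum mu' (mu j0).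
rewrite (bigID (mem (supp mu'))) /= => e.
(* The terms in which the row lands on an empty one are all equal to the orbit
   sum of mu; there are z > 0 of them, and the other terms have fewer rows. *)
pose z := #|~: supp mu'|.
have eq1 : \sum_(j | j \notin supp mu') orbit_sum (addrow mu' (mu j0) j)
           = z%:R *: orbit_sum mu.
  rewrite (eq_bigr (fun=> orbit_sum mu)) => [|j].
    rewrite sumr_const scaler_nat (_ : z = #|[pred j | j \notin supp mu']|) //.
    by apply: eq_card => l; rewrite !inE.
  rewrite inE negbK => /eqP muj.
  rewrite -(orbit_sum_perm mu (tperm j j0)); apply: eq_bigr => s _.
  apply: eq_mono => i; rewrite /comp /addrow; case: tpermP => [->|->|/eqP ne1 /eqP ne2].
  - by rewrite eqxx muj /=; case: (mu j0).
  - case: eqP => [->|ne]; first by rewrite muj /=; case: (mu j).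
    by move: muj; rewrite !mu'E eqxx; case: eqP => [/esym //|_ ->].
  - by rewrite (negPf ne1) mu'E (negPf ne2).
have -> : orbit_sum mu = (z%:R : F)^-1 *:
    (orbit_sum mu' * psum (mu j0)
     - \sum_(j in supp mu') orbit_sum (addrow mu' (mu j0) j)).
  rewrite e eq1 addrAC subrr add0r scalerA mulVf ?scale1r // pnatr_eq0 -lt0n.
  by rewrite /z (cardD1 j0) !inE mu'E !eqxx.
rewrite -mul_mpolyC; apply: (stableM); apply: stableD.
  by apply: stableM; apply: stable_psum.
rewrite -mulN1r; apply: stableM; apply: stable_sum => j jin.
have jne : j != j0 by move: jin; rewrite supp' !inE => /andP[].
apply: IH.
- rewrite -ltnS (leq_trans _ le_r) // [X in (_ < X)%N](cardD1 j0) inE nz ltnS.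
  apply: subset_leq_card; apply/subsetP => l; rewrite !inE /addrow.
  case: (l =P j) => [->|_]; first by move: jin; rewrite supp' !inE.
  by rewrite mu'E; case: (l == j0); rewrite ?eqxx.
- move=> l; rewrite /addrow; case: ifP => // _.
  move: (ev' l) (ev j0); rewrite /even_pair /= => e1 e2.
  by rewrite addnACA oddD (negPf e1) (negPf e2).
- exists j; rewrite /addrow eqxx; apply: contra nz.
  case: (mu j0) (mu' j) => a b [c d] /eqP[/eqP + /eqP].
  by rewrite !addn_eq0 => /andP[_ /eqP ->] /andP[_ /eqP ->].
Qed.

Let perm_mx_signed (s : 'S_n) : perm_mx s \in signed_perm_mx (F := F) (n := n).
Proof.
apply/and3P; split; apply/forallP => i.
- by apply/forallP => j; rewrite !mxE !inE; case: (_ == j); rewrite eqxx ?orbT.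
- apply/eqP; rewrite -(cards1 (s i)); apply: eq_card => j.
  by rewrite !inE !mxE pnatr_eq0 eqb0 negbK eq_sym.
- apply/eqP; rewrite -(cards1 ((s^-1)%g i)); apply: eq_card => j.
  by rewrite !inE !mxE pnatr_eq0 eqb0 negbK (canF_eq (permK s)).
Qed.

Let flip (i : 'I_n) : 'M[F]_n := diag_mx (\row_j (-1) ^+ (j == i)).

Let flip_signed i : flip i \in signed_perm_mx (F := F) (n := n).
Proof.
have nz j l : (flip i j l != 0) = (j == l).
  rewrite !mxE; case: (j =P l) => [->|_]; last by rewrite mulr0n eqxx.
  by rewrite mulr1n signr_eq0.
apply/and3P; split; apply/forallP => j.
- apply/forallP => l; rewrite !mxE !inE.
  case: (j == l); last by rewrite mulr0n eqxx.
  by case: (_ == i); rewrite mulr1n ?expr0 ?expr1 eqxx ?orbT.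
- by apply/eqP; rewrite -(cards1 j); apply: eq_card => l; rewrite !inE nz eq_sym.
- by apply/eqP; rewrite -(cards1 j); apply: eq_card => l; rewrite !inE nz.
Qed.

Lemma diag_actE (w : 'M[F]_n) (p : R) :
  diag_act w p = \sum_(m <- msupp p) p@_m *: diag_act w (mono (rows m)).
Proof.
by rewrite /diag_act comp_mpolyEX; under [RHS]eq_bigr do rewrite -mpolyX_rows.
Qed.

Lemma diag_act_mono (w : 'M[F]_n) mu : diag_act w (mono mu) =
  \prod_i ((\sum_j w j i *: 'X_(lshift n j)) ^+ (mu i).1 *
           (\sum_j w j i *: 'X_(rshift n j)) ^+ (mu i).2).
Proof.
rewrite /diag_act rmorph_prod; apply: eq_bigr => i _.
rewrite rmorphM !rmorphXn /= !comp_mpolyXU -!tnth_nth !tnth_mktuple.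
congr (_ ^+ _ * _ ^+ _).
  case: splitP => j /= e; first by have -> : j = i by apply: val_inj.
  by have := ltn_ord i; rewrite e ltnNge leq_addr.
case: splitP => j /= e; first by have := ltn_ord j; rewrite -e ltnNge leq_addr.
by have -> : j = i by apply: val_inj; move/addnI: e.
Qed.

Lemma diag_act_perm (s : 'S_n) mu :
  diag_act (perm_mx s) (mono mu) = mono (mu \o s).
Proof.
have sel f i : \sum_j (perm_mx s : 'M[F]_n) j i *: 'X_(f j)
    = 'X_(f ((s^-1)%g i)) :> R.
  rewrite (bigD1 ((s^-1)%g i)) //= !mxE permKV eqxx scale1r big1 ?addr0 // => j ne.
  by rewrite !mxE (canF_eq (permK s)) (negPf ne) scale0r.
rewrite diag_act_mono /mono [RHS](reindex_inj (@perm_inj _ s^-1)%g) /=.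
by apply: eq_bigr => i _; rewrite !sel /xmon permKV.
Qed.

Lemma diag_act_flip i mu : diag_act (flip i) (mono mu) =
  (-1) ^+ ((mu i).1 + (mu i).2) *: mono mu.
Proof.
have sel f j : \sum_l flip i l j *: 'X_(f l)
    = (-1) ^+ (j == i) *: 'X_(f j) :> R.
  rewrite (bigD1 j) //= !mxE eqxx mulr1n big1 ?addr0 // => l ne.
  by rewrite !mxE (negPf ne) mulr0n scale0r.
rewrite diag_act_mono /mono (bigD1 i) //= [in RHS](bigD1 i) //= [RHS]scalerAl.
congr (_ * _).
  by rewrite !sel eqxx expr1 !exprZn -scalerAl -scalerAr scalerA -exprD.
by apply: eq_bigr => j ne; rewrite !sel (negPf ne) expr0 !scale1r.
Qed.

Lemma coinv_ideal_ind p : p \in @coinv_ideal F n -> P p.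
Proof.
move/asboolP => [s [Gs ->]]; rewrite big_seq.
elim/big_ind: _ => // -[g h] /Gs /= [invh h0] {s Gs}.
suff: stable h by apply.
(* Invariance under the sign change in the i-th row makes that row even. *)
have par m : m \in msupp h -> forall i, even_pair (rows m i).
  move=> mh i; apply/negP => od.
  have /(congr1 (mcoeff m)) := invh _ (flip_signed i).
  rewrite diag_actE raddf_sum /=.
  rewrite (eq_bigr (fun m' => h@_m' * (-1) ^+ ((rows m' i).1 + (rows m' i).2)
     * (m' == m)%:R)) => [|m' _]; last first.
    by rewrite diag_act_flip !mcoeffZ -mpolyX_rows mcoeffX mulrA.
  rewrite (bigD1_seq m) ?msupp_uniq //= eqxx mulr1 big1_seq ?addr0; last first.
    by move=> m' /andP[/negPf -> _]; rewrite mulr0.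
  rewrite -signr_odd od expr1 mulrN1 => /eqP.
  by rewrite eqNr (negPf (_ : h@_m != 0)) // -mcoeff_msupp.
(* Averaging over the permutations turns h into orbit sums. *)
have sym : h = (n`!%:R : F)^-1 *: \sum_(m <- msupp h) h@_m *: orbit_sum (rows m).
  have nf : n`!%:R != 0 :> F by rewrite pnatr_eq0 -lt0n fact_gt0.
  have -> : \sum_(m <- msupp h) h@_m *: orbit_sum (rows m)
      = \sum_(s : 'S_n) diag_act (perm_mx s) h.
    under eq_bigr do rewrite /orbit_sum scaler_sumr.
    rewrite exchange_big /=; apply: eq_bigr => s _.
    by rewrite diag_actE; apply: eq_bigr => m _; rewrite diag_act_perm.
  under eq_bigr => s _ do rewrite (invh _ (perm_mx_signed s)).
  rewrite sumr_const card_Sn -scaler_nat scalerA mulVf ?scale1r //.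
rewrite sym -mul_mpolyC; apply: stableM.
rewrite big_seq; apply: stable_sum => m mh.
rewrite -mul_mpolyC; apply: stableM.
apply: stable_orbit_sum; first exact: par.
apply: contrapT => nex; move: mh; rewrite mcoeff_msupp.
suff -> : m = 0%MM by rewrite h0 eqxx.
apply/mnmP => k; rewrite mnm0E.
have z i : rows m i = (0, 0)%N by apply: contrapT => /eqP ?; apply: nex; exists i.
case: (split_ordP k) => i ->; by case: (z i).
Qed.

End PowerSumIdeal.
End Monomials.

(** * Finite dimension of the coinvariant ring *)

Section Nilpotence.
Variables (F : numFieldType) (n : nat).
Local Notation R := {mpoly F[n + n]}.

Lemma coinv_idealM (p q : R) : q \in @coinv_ideal F n -> p * q \in @coinv_ideal F n.
Proof. exact: idealMr. Qed.

Section Variables.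
Variable f : 'I_n -> 'I_(n + n).
Hypothesis act_f : forall (w : 'M[F]_n) i,
  diag_act w ('X_(f i)) = \sum_j w j i *: 'X_(f j).

Let act_sqr w : w \in signed_perm_mx (F := F) (n := n) ->
  exists2 h : 'I_n -> 'I_n, injective h &
    forall i, diag_act w ('X_(f i)) ^+ 2 = 'X_(f (h i)) ^+ 2.
Proof.
case/and3P=> /forallP vals /forallP rowsP /forallP cols.
have ex i : exists j, [set l | w l i != 0] == [set j].
  by have /cards1P[j ->] := cols i; exists j.
pose h i := xchoose (ex i).
have hE i l : (w l i != 0) = (l == h i).
  by have /eqP/setP/(_ l) := xchooseP (ex i); rewrite !inE.
exists h => [i i' e|i].
  have /cards1P[j ej] := rowsP (h i).
  have : i \in [set l | w (h i) l != 0] by rewrite inE hE.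
  have : i' \in [set l | w (h i) l != 0] by rewrite inE hE e.
  by rewrite ej !inE => /eqP -> /eqP ->.
rewrite act_f (bigD1 (h i)) //= big1 ?addr0 => [|l]; last first.
  by rewrite -hE negbK => /eqP ->; rewrite scale0r.
have := hE i (h i); have /forallP/(_ i) := vals (h i).
rewrite eqxx !inE => /or3P[] /eqP ->; rewrite ?eqxx // => _.
  by rewrite scale1r.
by rewrite scaleN1r sqrrN.
Qed.

(** The square x_i^2 is a root of prod_r (t - x_r^2), whose coefficients other
    than the leading one are invariants of positive degree. *)
Lemma sqr_var_nilpotent i : 'X_(f i) ^+ 2 ^+ n \in @coinv_ideal F n.
Proof.
pose rs := [seq 'X_(f r) ^+ 2 : R | r <- enum 'I_n].
pose P : {poly R} := \prod_(a <- rs) ('X - a%:P).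
have sP : size P = n.+1 by rewrite /P size_prod_XsubC size_map size_enum_ord.
have lP : P`_n = 1.
  by have /monicP := monic_prod_XsubC rs xpredT id; rewrite /lead_coef -/P sP.
have root : P.[ 'X_(f i) ^+ 2 ] = 0.
  by apply/eqP; rewrite -/(root _ _) root_prod_XsubC; apply/mapP; exists i; rewrite ?mem_enum.
have PE : P = \prod_r ('X - ('X_(f r) ^+ 2)%:P) by rewrite /P big_map big_enum.
clearbody P; clear rs.
have inv w k : w \in signed_perm_mx (F := F) (n := n) -> diag_act w P`_k = P`_k.
  move=> wW; have [h hi hE] := act_sqr wW.
  rewrite /diag_act; set t := [tuple _ | _ < _].
  rewrite -(coef_map (comp_mpoly t)); suff -> : map_poly (comp_mpoly t) P = P by [].
  have PEh : P = \prod_r ('X - ('X_(f (h r)) ^+ 2)%:P) 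
    by rewrite PE; exact: (reindex_inj hi).
  rewrite [in RHS]PEh [in LHS]PE rmorph_prod /=.
  apply: eq_bigr => r _; rewrite rmorphB /= map_polyX map_polyC.
  have e : 'X_(f r) ^+ 2 \mPo t = 'X_(f (h r)) ^+ 2 :> R.
    by rewrite rmorphXn; exact: hE.
  by rewrite -e.
have c0 k : (k < n)%N -> (P`_k)@_0%MM = 0.
  move=> kn; rewrite -(coef_map (mcoeff 0%MM)) PE rmorph_prod.
  rewrite (eq_bigr (fun=> 'X)) => [|r _]; last first.
    have e : ('X_(f r) ^+ 2 : R)@_0%MM = 0.
      by rewrite mpolyXn mcoeffX -mdeg_eq0 mdegMn mdeg1.
    by rewrite rmorphB /= map_polyX map_polyC /= e subr0.
  by rewrite prodr_const card_ord coefXn ltn_eqF.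
have -> : 'X_(f i) ^+ 2 ^+ n = - \sum_(k < n) 'X_(f i) ^+ 2 ^+ k * P`_k :> R.
  apply/eqP; rewrite -addr_eq0 addrC -[X in _ == X]root horner_coef sP big_ord_recr /= lP mul1r.
  by apply/eqP; congr (_ + _); apply: eq_bigr => k _; rewrite mulrC.
rewrite rpredN rpred_sum // => k _; apply: coinv_idealM.
apply/asboolP; exists [:: (1, P`_k)]; split; last by rewrite big_seq1 mul1r.
move=> u; rewrite inE => /eqP -> /=; split; first by move=> w; apply: inv.
exact: c0.
Qed.

End Variables.

Lemma monomial_in_coinv_ideal (m : 'X_{1..n + n}) (k : 'I_(n + n)) :
  (2 * n <= m k)%N -> 'X_[m] \in @coinv_ideal F n.
Proof.
move=> mk; rewrite mpolyXE_id (bigD1 k) //= mulrC -(subnKC mk) exprD exprM mulrCA.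
rewrite mulrC; apply: coinv_idealM.
case: (split_ordP k) => i ->; apply: sqr_var_nilpotent => w l;
  rewrite /diag_act comp_mpolyXU -tnth_nth tnth_mktuple; case: splitP => j /= e.
- by have -> : j = l by apply: val_inj.
- by have := ltn_ord l; rewrite e ltnNge leq_addr.
- by have := ltn_ord j; rewrite -e ltnNge leq_addr.
- by have -> : j = l by apply: val_inj; move/addnI: e.
Qed.

End Nilpotence.

(** * The module V^(tensor n) *)

Section TensorModule.
Variables (F : numFieldType) (n : nat).
Local Notation R := {mpoly F[n + n]}.
Local Notation M := 'M[F]_((2 * n).+1).
Implicit Types (A B : 'I_n -> M) (mu : 'I_n -> nat * nat).

Definition idx := {ffun 'I_n -> 'I_(2 * n).+1}.
(** V^(tensor n) as functions on the multi-indices of its monomial basis. *)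
Definition tspace := {ffun idx -> F^o}.
Implicit Types (u w : tspace) (k l : idx).

(** The tensor product of the operators [A i]. *)
Definition tens A u : tspace :=
  [ffun k : idx => \sum_(l : idx) (\prod_i A i (k i) (l i)) * u l].

Lemma tens_is_linear A : linear (tens A).
Proof.
move=> a u w; apply/ffunP => k; rewrite !ffunE /=.
rewrite /GRing.scale /= mulr_sumr -big_split /=; apply: eq_bigr => l _.
by rewrite !ffunE mulrDr mulrCA.
Qed.

HB.instance Definition _ A :=
  GRing.isLinear.Build F tspace tspace _ (tens A) (tens_is_linear A).

Lemma eq_tens A B u : A =1 B -> tens A u = tens B u.
Proof.
move=> e; apply/ffunP => k; rewrite !ffunE; apply: eq_bigr => l _.
by congr (_ * _); apply: eq_bigr => i _; rewrite e.
Qed.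

Lemma tensM A B u : tens A (tens B u) = tens (fun i => A i * B i) u.
Proof.
apply/ffunP => k; rewrite !ffunE.
under eq_bigr do rewrite ffunE mulr_sumr.
rewrite exchange_big /=; apply: eq_bigr => l _.
under eq_bigr do rewrite mulrA -big_split /=.
rewrite -mulr_suml; congr (_ * _).
rewrite (eq_bigr (fun i => \sum_j A i (k i) j * B i j (l i))) => [|i _]; last first.
  by rewrite mxE.
by rewrite bigA_distr_bigA.
Qed.

Definition slot_family (i : 'I_n) (N : M) (j : 'I_n) : M := if j == i then N else 1.
Definition slot i N := tens (slot_family i N).

Lemma tens1 u : tens (fun=> 1) u = u.
Proof.
apply/ffunP => k; rewrite ffunE (bigD1 k) //= big1 ?mul1r => [|i _]; last first.
  by rewrite mxE eqxx.
rewrite big1 ?addr0 // => l ne.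
have [i ki] : exists i, k i != l i.
  apply/existsP; apply: contraNT ne; rewrite negb_exists => /forallP e.
  by apply/eqP/ffunP => i; have := e i; rewrite negbK => /eqP.
by rewrite (bigD1 i) //= mxE (negPf ki) !mul0r.
Qed.

Lemma slotM i N N' u : slot i (N * N') u = slot i N (slot i N' u).
Proof.
rewrite /slot tensM; apply: eq_tens => j; rewrite /slot_family.
by case: eqP; rewrite ?mul1r.
Qed.

Lemma slotE i N u k :
  slot i N u k = \sum_j N (k i) j * u [ffun l => if l == i then j else k l].
Proof.
rewrite ffunE; pose h j : idx := [ffun l => if l == i then j else k l].
rewrite (bigID (fun l => h (l i) == l)) /= [X in _ + X]big1 ?addr0 => [|l nl].
  rewrite (reindex_onto h (fun l : idx => l i)) => [|l /eqP //].
  rewrite (eq_bigl xpredT) => [|j]; last by rewrite ffunE !eqxx.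
  apply: eq_bigr => j _; congr (_ * _).
  rewrite (bigD1 i) //= /slot_family eqxx ffunE eqxx big1 ?mulr1 // => a /negPf ai.
  by rewrite ai ffunE ai mxE eqxx.
have [j ji kj] : exists2 j, j != i & k j != l j.
  apply/exists_inP; apply: contraNT nl; rewrite negb_exists_in => /forall_inP e.
  apply/eqP/ffunP => j; rewrite ffunE.
  by case: eqP => [-> //|/eqP /e]; rewrite negbK => /eqP.
by rewrite (bigD1 j) //= /slot_family (negPf ji) mxE (negPf kj) !mul0r.
Qed.

Lemma slotD i N N' u : slot i (N + N') u = slot i N u + slot i N' u.
Proof.
apply/ffunP => k; rewrite [RHS]ffunE !slotE -big_split /=; apply: eq_bigr => j _.
by rewrite mxE mulrDl.
Qed.

Lemma slotZ i a N u : slot i (a *: N) u = a *: slot i N u.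
Proof.
apply/ffunP => k; rewrite [RHS]ffunE !slotE /GRing.scale /= mulr_sumr.
by apply: eq_bigr => j _; rewrite mxE mulrA.
Qed.

Definition omit A i j : M := if j == i then 1 else A j.

Lemma tens_slot A i u : tens A u = slot i (A i) (tens (omit A i) u).
Proof.
rewrite /slot tensM; apply: eq_tens => j; rewrite /slot_family /omit.
by case: eqP => [->|_]; rewrite ?mulr1 ?mul1r.
Qed.

Lemma slot_omit A i N u : slot i N (tens (omit A i) u) = tens (omit A i) (slot i N u).
Proof.
rewrite /slot !tensM; apply: eq_tens => j; rewrite /slot_family /omit.
by case: eqP => _; rewrite ?mulr1 ?mul1r.
Qed.

Definition raising : M := \matrix_(i, j) (i == j.+1 :> nat)%:R.
(** These weights vanish at 0 and 2n+1 and nowhere in between, so that Y is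
    well defined on F^(2n+1) and has no other kernel than the bottom vector. *)
Definition weight (j : nat) : F := j%:R - (odd j)%:R * (2 * n).+1%:R.
Definition lowering : M := \matrix_(i, j) ((i.+1 == j :> nat)%:R * weight j).
Definition parity : M := diag_mx (\row_j (-1) ^+ j).
Local Notation X := raising.
Local Notation Y := lowering.
Local Notation S := parity.

Lemma lowering_raising :
  Y * X = X * Y + 1 - (2 * n).+1%:R *: S.
Proof.
apply/matrixP => i j; rewrite !mxE.
have -> : \sum_l Y i l * X l j = (i == j)%:R * (if (j < 2 * n)%N then weight j.+1 else 0).
  have [lt|ge] := ltnP j (2 * n).
    have lt' : (j.+1 < (2 * n).+1)%N by [].
    rewrite (bigD1 (Ordinal lt')) //= !mxE /= eqxx mulr1 eqSS big1 ?addr0 //.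
    by move=> l; rewrite -val_eqE /= => /negPf ne; rewrite !mxE ne mulr0.
  rewrite mulr0 big1 // => l _; rewrite !mxE.
  by rewrite [_ == j.+1]ltn_eqF ?mulr0 // (leq_trans (ltn_ord l)) ?ltnS.
have -> : \sum_l X i l * Y l j = (i == j)%:R * (if (0 < j)%N then weight j else 0).
  have [lt|] := posnP j.
    rewrite mulr0 big1 // => l _; rewrite !mxE lt.
    by rewrite [_ == 0%N]gtn_eqF ?mul0r ?mulr0.
  move=> gt; have lt' : (j.-1 < (2 * n).+1)%N by rewrite prednK // ltnW.
  rewrite (bigD1 (Ordinal lt')) //= !mxE /= prednK // eqxx mul1r big1 ?addr0 //.
  move=> l; rewrite -val_eqE /= => ne; rewrite !mxE.
  rewrite [_ == nat_of_ord j]negbTE ?mul0r ?mulr0 //.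
  by apply: contra ne => /eqP <-.
have w0 : weight 0 = 0 by rewrite /weight mul0r subrr.
have wN : weight (2 * n).+1 = 0.
  by rewrite /weight /= mul2n odd_double /= mul1r subrr.
have -> : (if (0 < j)%N then weight j else 0) = weight j.
  by case: (posnP j) => // ->.
have -> : (if (j < 2 * n)%N then weight j.+1 else 0) = weight j.+1.
  case: ltnP => // ge; suff -> : nat_of_ord j = (2 * n)%N by [].
  by apply/eqP; rewrite eqn_leq ge -ltnS ltn_ord.
case: eqP => [->|_]; last by rewrite !mulr0n !mul0r mulr0 !addr0 subrr.
rewrite !mul1r !mulr1n /weight /= -signr_odd -[in LHS]natr1.
by case: (odd j); rewrite /= ?expr0 ?expr1; ring.
Qed.

Lemma parity_raising : S * X = - (X * S).
Proof.
apply/matrixP => i j; rewrite -[S * X]/(S *m X) -[X * S]/(X *m S) mul_diag_mx mul_mx_diag !mxE.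
case: eqP => [->|_]; last by rewrite mulr0 mul0r oppr0.
by rewrite exprS mulN1r mulr1 mul1r.
Qed.

Lemma parity_lowering : S * Y = - (Y * S).
Proof.
apply/matrixP => i j; rewrite -[S * Y]/(S *m Y) -[Y * S]/(Y *m S) mul_diag_mx mul_mx_diag !mxE.
case: eqP => [<-|_]; last by rewrite !mul0r mulr0 oppr0.
by rewrite exprS mulN1r !mul1r mulrN opprK mulrC.
Qed.

Lemma parity_lowering_exp t : S * Y ^+ t = (-1) ^+ t *: (Y ^+ t * S).
Proof.
elim: t => [|t IH]; first by rewrite !expr0 mulr1 mul1r scale1r.
rewrite (exprS Y) mulrA parity_lowering mulNr -(mulrA Y S) IH -scalerAr !(mulrA Y).
by rewrite exprS mulN1r scaleNr.
Qed.

Lemma parity_raising_exp t : S * X ^+ t = (-1) ^+ t *: (X ^+ t * S).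
Proof.
elim: t => [|t IH]; first by rewrite !expr0 mulr1 mul1r scale1r.
rewrite (exprS X) mulrA parity_raising mulNr -(mulrA X S) IH -scalerAr !(mulrA X).
by rewrite exprS mulN1r scaleNr.
Qed.

(** Normal ordering: moving Y to the right of X^(s+1) costs a term in which the
    degree has dropped by 2, up to the parity operator. *)
Lemma lowering_raising_exp s : exists a b : F,
  Y * X ^+ s.+1 = X ^+ s.+1 * Y + X ^+ s * (a%:A + b *: S).
Proof.
pose h : F := (2 * n).+1%:R.
elim: s => [|s [a [b IH]]].
  exists 1, (- h); rewrite expr0 mul1r scaleNr scale1r expr1.
  by rewrite addrA; apply: lowering_raising.
exists (a + 1), (b - h * (-1) ^+ s.+1).
rewrite (exprS X s.+1) mulrA lowering_raising mulrBl mulrDl mul1r.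
rewrite -(mulrA X Y) IH mulrDr mulrA -scalerAl parity_raising_exp.
rewrite (mulrA X (X ^+ s)) -exprS -!addrA; congr (_ + _).
rewrite !scalerDl scaleNr scale1r !mulrDr mulrN mulr1 -!scalerAr !scalerA -/h.
rewrite -exprS mulr1 -!addrA; congr (_ + _).
by rewrite addrCA.
Qed.

Definition oddidx (j : 'I_n) : 'I_(2 * n).+1 := inord (2 * j).+1.

Lemma oddidxE j : oddidx j = (2 * j).+1 :> nat.
Proof. by rewrite inordK // !ltnS; have := ltn_ord j; lia. Qed.

Lemma odd_oddidx j : odd (oddidx j).
Proof. by rewrite oddidxE /= mul2n odd_double. Qed.

(** The tensor that is alternating in the odd basis vectors of V. *)
Definition vac : tspace := [ffun k : idx => \det (\matrix_(i, j) (k i == oddidx j)%:R)].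

(** Expanding the determinant of [vac] turns a tensor product of operators into
    a determinant of matrix entries. *)
Lemma tens_vac A k : tens A vac k = \det (\matrix_(i, j) A i (k i) (oddidx j)).
Proof.
rewrite ffunE; under eq_bigr do rewrite ffunE mulr_sumr.
rewrite exchange_big /=; apply: eq_bigr => s _.
under eq_bigr do rewrite mulrCA -big_split /=.
rewrite -mulr_sumr; congr (_ * _).
rewrite (bigD1 [ffun i => oddidx (s i)]) //= [X in _ + X]big1 ?addr0 => [|l ne].
  by apply: eq_bigr => i _; rewrite !mxE !ffunE eqxx mulr1.
have [i li] : exists i, l i != oddidx (s i).
  apply/existsP; apply: contraNT ne; rewrite negb_exists => /forallP e.
  by apply/eqP/ffunP => i; have := e i; rewrite negbK ffunE => /eqP.
by rewrite (bigD1 i) //= !mxE (negPf li) mulr0 mul0r.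
Qed.

Definition alternating u :=
  forall k (s : 'S_n), u [ffun i => k (s i)] = (-1) ^+ s * u k.

Lemma tens_vac_perm A k (s : 'S_n) :
  tens A vac [ffun i => k (s i)] = (-1) ^+ s * tens (A \o (s^-1)%g) vac k.
Proof.
rewrite !tens_vac -det_perm -det_mulmx -row_permE; congr (\det _).
by apply/matrixP => i j; rewrite !mxE ffunE /= permK.
Qed.

Lemma sum_alternating (I : finType) (A : I -> 'I_n -> M) (h : 'S_n -> I -> I) :
  (forall s, injective (h s)) -> (forall s i, A (h s i) =1 A i \o s) ->
  alternating (\sum_i tens (A i) vac).
Proof.
move=> hi hA k s; rewrite !sum_ffunE mulr_sumr (reindex_inj (hi s)) /=.
apply: eq_bigr => i _; rewrite tens_vac_perm; congr (_ * _).
congr ((_ : tspace) _); apply: eq_tens => j; by rewrite /= hA /= permKV.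
Qed.

(** An alternating tensor vanishes at a multi-index with a repetition. *)
Lemma alternating_eq u w : alternating u -> alternating w ->
  (forall k, injective k -> u k = w k) -> u = w.
Proof.
move=> au aw e; apply/ffunP => k.
have [/injectiveP/e //|/injectivePn[i [j ij kij]]] := boolP (injectiveb k).
have z (t : tspace) : alternating t -> t k = 0.
  move=> /(_ k (tperm i j)); rewrite odd_tperm ij expr1 mulN1r.
  suff -> : [ffun l => k (tperm i j l)] = k.
    by move/eqP; rewrite eq_sym eqNr => /eqP.
  by apply/ffunP => l; rewrite ffunE; case: tpermP => [->|->|].
by rewrite !z.
Qed.

(** Matrices that are homogeneous of degree [b] for the parity grading of V. *)
Definition par_mx b (N : M) := forall i j : 'I_(2 * n).+1, odd i != odd j (+) b -> N i j = 0.

Lemma par_mx1 : par_mx false 1.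
Proof. by move=> i j; rewrite addbF mxE; case: (i =P j) => [->|//]; rewrite eqxx. Qed.

Lemma par_mxM b c N N' : par_mx b N -> par_mx c N' -> par_mx (b (+) c) (N * N').
Proof.
move=> pN pN' i j ne; rewrite mxE big1 // => l _.
have [e|/pN ->] := boolP (odd i == odd l (+) b); last by rewrite mul0r.
rewrite pN' ?mulr0 //; apply: contra ne => /eqP e'.
by rewrite (eqP e) e' -addbA [c (+) b]addbC.
Qed.

Lemma par_mxX b N t : par_mx b N -> par_mx (b && odd t) (N ^+ t).
Proof.
move=> pN; elim: t => [|t IH]; first by rewrite andbF; apply: par_mx1.
rewrite exprS (_ : b && _ = b (+) (b && odd t)); first exact: par_mxM.
by case: b {pN IH} => //=; case: (odd t).
Qed.

Lemma par_raising : par_mx true X.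
Proof.
by move=> i j; rewrite mxE; case: (@eqP nat i j.+1) => [->|//]; rewrite /= addbT eqxx.
Qed.

Lemma par_lowering : par_mx true Y.
Proof.
move=> i j; rewrite mxE; case: (@eqP nat i.+1 j) => [<-|_ _]; last by rewrite mul0r.
by rewrite /= addbT negbK eqxx.
Qed.

Definition xy_mx (nu : nat * nat) : M := X ^+ nu.1 * Y ^+ nu.2.

Lemma par_xy nu : par_mx (odd (nu.1 + nu.2)) (xy_mx nu).
Proof.
rewrite oddD; apply: par_mxM; [exact: (par_mxX par_raising)|].
exact: (par_mxX par_lowering).
Qed.

Lemma tens_vac_par A k i b : par_mx b (A i) -> odd (k i) = b -> tens A vac k = 0.
Proof.
move=> pA kb; rewrite tens_vac (expand_det_row _ i) big1 // => j _.
by rewrite mxE pA ?mul0r // odd_oddidx kb; case: b {pA kb}.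
Qed.

(** The polynomial [p] applied to [vac], with the X's to the left of the Y's in
    each factor. *)
Definition Phi : R -> tspace := lin_ext (fun m => tens (fun i => xy_mx (rows m i)) vac).

HB.instance Definition _ := GRing.Linear.on Phi.

Lemma Phi_mono mu : Phi (mono F mu) = tens (fun i => xy_mx (mu i)) vac.
Proof. by rewrite mono_mexp /Phi lin_extX; apply: eq_tens => i; rewrite rows_mexp. Qed.

Lemma PhiX m : Phi 'X_[m] = tens (fun i => xy_mx (rows m i)) vac.
Proof. by rewrite /Phi lin_extX. Qed.

Lemma Phi1 : Phi 1 = vac.
Proof.
rewrite -mpolyX0 PhiX -[RHS]tens1; apply: eq_tens => i.
by rewrite /xy_mx /rows /= !mnm0E !expr0 mulr1.
Qed.

(** The filtration by degree; the index bounds the size of the polynomial, so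
    [filt d] means degree less than [d]. *)
Definition filt d u := exists2 p, (msize p <= d)%N & u = Phi p.

Lemma filt_le d e u : (d <= e)%N -> filt d u -> filt e u.
Proof. by move=> de [p pd ->]; exists p; rewrite // (leq_trans pd). Qed.

Lemma filt0 d : filt d 0.
Proof. by exists 0; rewrite ?msize0 // linear0. Qed.

Lemma filtD d u w : filt d u -> filt d w -> filt d (u + w).
Proof.
move=> [p pd ->] [q qd ->]; exists (p + q); last by rewrite linearD.
by rewrite (leq_trans (msizeD_le _ _)) // geq_max pd.
Qed.

Lemma filtZ d a u : filt d u -> filt d (a *: u).
Proof.
move=> [p pd ->]; exists (a *: p); last by rewrite linearZ.
by rewrite (leq_trans (msizeZ_le _ _)).
Qed.

Lemma filtN d u : filt d u -> filt d (- u).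
Proof. by rewrite -scaleN1r; apply: filtZ. Qed.

Lemma filt_sum d (I : Type) (r : seq I) (P : pred I) (f : I -> tspace) :
  (forall i, P i -> filt d (f i)) -> filt d (\sum_(i <- r | P i) f i).
Proof.
by move=> h; elim/big_ind: _ => //; [exact: filt0 | exact: filtD].
Qed.

Lemma filtX m : filt (mdeg m).+1 (Phi 'X_[m]).
Proof. by exists 'X_[m]; rewrite ?msizeX. Qed.

Definition act (k : 'I_(n + n)) : tspace -> tspace :=
  match split k with inl i => slot i X | inr i => slot i Y end.

Lemma act_linear (k : 'I_(n + n)) : linear (act k).
Proof. by rewrite /act; case: (split k) => i; apply: tens_is_linear. Qed.

HB.instance Definition _ (k : 'I_(n + n)) :=
  GRing.isLinear.Build F tspace tspace _ (act k) (act_linear k).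

Lemma slot_parity_vac i : slot i S vac = - vac.
Proof.
apply/ffunP => k; rewrite slotE ffunE (bigD1 (k i)) //= mxE eqxx mulr1n big1 ?addr0.
  have -> : [ffun l => if l == i then k i else k l] = k.
    by apply/ffunP => l; rewrite ffunE; case: eqP => [->|].
  rewrite mxE -signr_odd; case: (boolP (odd (k i))) => [_|ev].
    by rewrite expr1 mulN1r.
  rewrite -[vac]tens1 (@tens_vac_par _ _ i false) ?mulr0 ?oppr0 //.
    exact: par_mx1.
  exact: negbTE.
by move=> l /negPf ne; rewrite mxE eq_sym ne mulr0n mul0r.
Qed.

End TensorModule.

(** * The invariants lower the degree *)

Section FilteredAction.
Variables (F : numFieldType) (n : nat).
Local Notation R := {mpoly F[n + n]}.
Local Notation M := 'M[F]_((2 * n).+1).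
Local Notation X := (raising F n).
Local Notation Y := (lowering F n).
Local Notation S := (parity F n).
Local Notation vac := (vac F n).
Local Notation act := (@act F n).
Local Notation Phi := (@Phi F n).
Local Notation xy_mx := (xy_mx F n).
Implicit Types (A B : 'I_n -> M) (mu : 'I_n -> nat * nat).
Implicit Types (u w : tspace F n) (k l : idx n) (m : 'X_{1..n + n}).

Lemma tens_slot_at A i u (N : M) (B := fun j => if j == i then N else A j) :
  tens B u = slot i N (tens (omit A i) u).
Proof.
rewrite (tens_slot B i) /B eqxx; congr (slot _ _ _); apply: eq_tens => j.
by rewrite /omit; case: eqP.
Qed.

Lemma rowsD m m' i :
  rows (m + m')%MM i = ((rows m i).1 + (rows m' i).1, (rows m i).2 + (rows m' i).2)%N.
Proof. by rewrite /rows !mnmDE. Qed.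

Lemma rows_lshift i j : rows (U_(lshift n i) : 'X_{1..n + n})%MM j = (j == i : nat, 0)%N.
Proof. by rewrite /rows !mnm1E !(inj_eq (@lshift_inj _ _)) eq_lrshift eq_sym. Qed.

Lemma rows_rshift i j : rows (U_(rshift n i) : 'X_{1..n + n})%MM j = (0, j == i : nat)%N.
Proof. by rewrite /rows !mnm1E !(inj_eq (@rshift_inj _ _)) eq_rlshift eq_sym. Qed.

Lemma act_lshift i m : act (lshift n i) (Phi 'X_[m]) = Phi ('X_(lshift n i) * 'X_[m]).
Proof.
rewrite -mpolyXD !PhiX /act (unsplitK (inl i)) /slot tensM; apply: eq_tens => j.
rewrite /xy_mx rowsD rows_lshift /slot_family /=.
by case: eqP => _; rewrite ?mul1r // mulrA -exprS.
Qed.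

(** The reordering of Y X^s Y^t contributes a multiple of X^(s-1) Y^t and a
    multiple of X^(s-1) S Y^t; the latter is also a multiple of the former on
    [vac], where S acts by -1. *)
Lemma act_rshift i m : exists2 u, filt (mdeg m).+1 u &
  act (rshift n i) (Phi 'X_[m]) = Phi ('X_(rshift n i) * 'X_[m]) + u.
Proof.
rewrite -mpolyXD !PhiX /act (unsplitK (inr i)).
set A := fun j => xy_mx (rows m j); pose w := tens (omit A i) vac.
have opw N : slot i (N * S) w = - slot i N w.
  rewrite slotM /w slot_omit slot_parity_vac linearN.
  exact: (linearN (tens (slot_family i N))).
have eA : tens A vac = slot i (xy_mx (rows m i)) w by apply: tens_slot.
have eB : tens (fun j => xy_mx (rows (U_(rshift n i) + m)%MM j)) vac
          = slot i (X ^+ (rows m i).1 * Y ^+ (rows m i).2.+1) w.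
  rewrite -tens_slot_at; apply: eq_tens => j; rewrite rowsD rows_rshift /A.
  by case: eqP => [->|_] //; rewrite add0n; case: (rows m j).
suff [u fu e] : exists2 u, filt (mdeg m).+1 u & slot i (Y * xy_mx (rows m i)) w
    = slot i (X ^+ (rows m i).1 * Y ^+ (rows m i).2.+1) w + u.
  by exists u; rewrite // eB -e slotM -eA.
rewrite /xy_mx; case e: (rows m i) => [[|s] t] /=.
  by exists 0; [exact: filt0 | rewrite addr0 !expr0 !mul1r -exprS].
have [a [b YX]] := lowering_raising_exp F n s.
exists ((a - b * (-1) ^+ t) *: slot i (X ^+ s * Y ^+ t) w).
  pose m' := (m - U_(lshift n i))%MM.
  have em : m = (U_(lshift n i) + m')%MM.
    by rewrite addmC submK // lep1mP -lt0n; case: e => ->.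
  suff -> : slot i (X ^+ s * Y ^+ t) w = Phi 'X_[m'].
    by apply: filtZ; apply: filt_le (filtX _ _); rewrite em mdegD mdeg1.
  rewrite PhiX -tens_slot_at; apply: eq_tens => j.
  have := rowsD U_(lshift n i)%MM m' j; rewrite -em rows_lshift /A.
  case: eqP => [->|_] /=; first by rewrite e => -[-> ->].
  by rewrite !add0n => ->.
rewrite mulrA YX mulrDl -mulrA -exprS slotD; congr (_ + _).
rewrite mulrDr mulrDl -!scalerAr mulr1 -!scalerAl -mulrA parity_lowering_exp.
rewrite -!scalerAr scalerA mulrA slotD !slotZ opw scalerBl scalerN.
by congr (_ - _).
Qed.

Lemma msizeXM m (p : R) : (msize ('X_[m] * p) <= mdeg m + msize p)%N.
Proof.
have [->|nz] := eqVneq p 0; first by rewrite mulr0 msize0.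
by rewrite msizeM ?msizeX // -msize_poly_eq0 msizeX.
Qed.

Lemma act_step (k : 'I_(n + n)) (p : R) :
  filt (msize p) (act k (Phi p) - Phi ('X_k * p)).
Proof.
have -> : act k (Phi p) - Phi ('X_k * p) = \sum_(m <- msupp p)
    p@_m *: (act k (Phi 'X_[m]) - Phi ('X_k * 'X_[m])).
  rewrite {1 2}[p]mpolyE mulr_sumr !(linear_sum Phi) (linear_sum (act k)) -sumrB.
  apply: eq_bigr => m _; rewrite -scalerAr !(linearZ_LR Phi) (linearZ_LR (act k)).
  by rewrite scalerBr.
rewrite big_seq; apply: filt_sum => m mp; apply: filtZ.
apply: filt_le (msize_mdeg_lt mp) _.
case: (split_ordP k) => i ->; first by rewrite act_lshift subrr; apply: filt0.
by have [u fu ->] := act_rshift i m; rewrite addrC addKr.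
Qed.

Lemma act_filt (k : 'I_(n + n)) d u : filt d u -> filt d.+1 (act k u).
Proof.
move=> [p pd ->]; rewrite -[act _ _](subrK (Phi ('X_k * p))); apply: filtD.
  by apply: filt_le (act_step k p); rewrite ltnW.
exists ('X_k * p) => //; apply: leq_trans (msizeXM _ _) _.
by rewrite mdeg1.
Qed.

Lemma vac_alternating : alternating vac.
Proof.
move=> k s; rewrite -[vac]tens1 tens_vac_perm; congr (_ * _).
Qed.

Lemma vac_oddidx : vac [ffun j => oddidx j] = 1.
Proof.
rewrite ffunE (_ : (\matrix_(i, j) _) = 1%:M) ?det1 //.
apply/matrixP => i j; rewrite !mxE ffunE -val_eqE /= !oddidxE eqSS eqn_mul2l /=.
by rewrite val_eqE.
Qed.

Lemma injective_odd_perm k : injective k -> (forall i, odd (k i)) ->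
  exists s : 'S_n, k = [ffun i => oddidx (s i)].
Proof.
move=> kI kodd.
have lt i : ((k i)./2 < n)%N by have := ltn_ord (k i); have := odd_double_half (k i);
  rewrite kodd; lia.
pose h i := Ordinal (lt i).
have kE i : k i = oddidx (h i).
  apply: val_inj; rewrite /= oddidxE /=.
  by have := odd_double_half (k i); rewrite kodd -[X in _ = X -> _]/(val (k i)) /=; lia.
have hI : injective h by move=> i j e; apply: kI; rewrite !kE e.
by exists (perm hI); apply/ffunP => i; rewrite ffunE permE.
Qed.

Lemma tscaleE a u k : (a *: u) k = a * u k.
Proof. by rewrite ffunE. Qed.

(** Uniqueness of [vac]: the odd basis vectors of V are n in number. *)
Lemma odd_alternating u : alternating u ->
  (forall k i, ~~ odd (k i) -> u k = 0) -> exists c, u = c *: vac.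
Proof.
move=> au ou; exists (u [ffun j => oddidx j]); apply: alternating_eq => //.
  by move=> k s; rewrite !tscaleE vac_alternating mulrCA.
move=> k kI; rewrite tscaleE.
case: (boolP [forall i, odd (k i)]) => [/forallP kodd|].
  have [s ->] := injective_odd_perm kI kodd.
  pose o : idx n := [ffun j => oddidx j].
  have -> : [ffun i => oddidx (s i)] = [ffun i => o (s i)].
    by apply/ffunP => i; rewrite !ffunE.
  by rewrite au vac_alternating vac_oddidx mulr1 mulrC.
rewrite negb_forall => /existsP[i ki]; rewrite (ou _ i) //.
rewrite -[vac]tens1 (@tens_vac_par _ _ _ _ i false) ?mulr0 //; first exact: par_mx1.
exact: negbTE.
Qed.

(** A power sum acts on [vac] through sum_i 1 (x) X^s Y^t (x) 1, which preserves
    both the alternation and, for even s + t, the parity of every factor. *)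
Lemma Phi_psum nu : even_pair nu -> exists c, Phi (psum F n nu) = c *: vac.
Proof.
move=> ev.
have -> : Phi (psum F n nu) = \sum_i tens (slot_family i (xy_mx nu)) vac.
  rewrite -[psum _ _ _]mul1r (_ : 1 = mono F (fun=> (0, 0)%N)); last first.
    by rewrite /mono big1 // => i _; rewrite /xmon !expr0 mulr1.
  rewrite mono_psum linear_sum; apply: eq_bigr => i _ /=.
  rewrite Phi_mono; apply: eq_tens => j; rewrite /addrow /slot_family.
  by case: eqP => _; rewrite /xy_mx /= ?expr0 ?mulr1.
apply: odd_alternating.
  apply: (@sum_alternating _ _ _ _ (fun s => (s^-1)%g)) => [s|s i j].
    exact: perm_inj.
  by rewrite /slot_family /= (canF_eq (permK s)).
move=> k i ki; rewrite sum_ffunE big1 // => j _.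
apply: (@tens_vac_par _ _ _ _ i false); last exact: negbTE.
rewrite /slot_family; case: eqP => _; last exact: par_mx1.
by rewrite -(negbTE ev); apply: par_xy.
Qed.

(** This is the reason why the ideal acts trivially on the associated graded
    space: the degree of the product is [mdeg m + (nu.1 + nu.2)], and its image
    lies in a strictly smaller degree. *)
Lemma filt_psum m nu : even_pair nu -> nu != (0, 0)%N ->
  filt (mdeg m + (nu.1 + nu.2)) (Phi ('X_[m] * psum F n nu)).
Proof.
move=> ev nz; move e: (mdeg m) => d; elim: d m e => [|d IH] m e.
  move/eqP: e; rewrite mdeg_eq0 => /eqP ->; rewrite mpolyX0 mul1r.
  have [c ->] := Phi_psum ev; apply: filtZ; rewrite -Phi1.
  exists 1 => //; rewrite msize1 add0n lt0n; apply: contra nz.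
  by case: nu {ev c} => a b; rewrite addn_eq0 => /andP[/= /eqP -> /eqP ->].
have [k mk] : exists k : 'I_(n + n), m k != 0%N.
  apply/existsP; apply: contra_eqT e; rewrite negb_exists => /forallP z.
  suff -> : m = 0%MM by rewrite mdeg0.
  by apply/mnmP => k; rewrite mnm0E; have := z k; rewrite negbK => /eqP.
pose m' := (m - U_(k))%MM.
have em : m = (U_(k) + m')%MM by rewrite addmC submK // lep1mP.
have dm' : mdeg m' = d by move: e; rewrite em mdegD mdeg1 => -[].
rewrite em mpolyXD -mulrA; set p := _ * psum _ _ _.
rewrite -[Phi _](subKr (act k (Phi p))) addSn; apply: filtD.
  by apply: act_filt; apply: IH.
apply: filtN; apply: filt_le (act_step k p).
apply: leq_trans (msizeXM _ _) _; rewrite dm'.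
rewrite -addnS leq_add2l; apply: leq_trans (msize_sum _ _ _) _.
by apply/bigmax_leqP => i _; rewrite /xmon !mpolyXn -mpolyXD msizeX mdegD !mdegMn !mdeg1 !mul1n.
Qed.

End FilteredAction.

(** * Semi-invariant vectors, and generation by the vacuum vector *)

Section Generation.
Variables (F : numFieldType) (n : nat).
Local Notation R := {mpoly F[n + n]}.
Local Notation M := 'M[F]_((2 * n).+1).
Local Notation X := (raising F n).
Local Notation Y := (lowering F n).
Local Notation vac := (vac F n).
Local Notation Phi := (@Phi F n).
Local Notation xy_mx := (xy_mx F n).
Implicit Types (A B : 'I_n -> M) (mu : 'I_n -> nat * nat).
Implicit Types (u w : tspace F n) (k l : idx n).

Lemma weight_neq0 j : (0 < j <= 2 * n)%N -> weight F n j != 0.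
Proof.
case/andP=> j0 jn; rewrite /weight; case: (boolP (odd j)) => oj.
  by rewrite mul1r subr_eq0 eqr_nat ltn_eqF // ltnS.
by rewrite mul0r subr0 pnatr_eq0 -lt0n.
Qed.

Lemma Phi_orbit_sum mu :
  Phi (orbit_sum F mu) = \sum_(s : 'S_n) tens (fun i => xy_mx (mu (s i))) vac.
Proof. by rewrite (linear_sum Phi); apply: eq_bigr => s _; exact: Phi_mono. Qed.

Lemma orbit_sum_alternating mu : alternating (Phi (orbit_sum F mu)).
Proof.
rewrite Phi_orbit_sum.
apply: (@sum_alternating _ _ _ _ (fun s t => (s * t)%g)) => [s|s t i].
  exact: mulgI.
by rewrite /= permM.
Qed.

Lemma orbit_sum_even mu k i : (forall j, ~~ even_pair (mu j)) -> odd (k i) ->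
  Phi (orbit_sum F mu) k = 0.
Proof.
move=> od ki; rewrite Phi_orbit_sum sum_ffunE big1 // => s _.
apply: (@tens_vac_par _ _ _ _ i true) => //.
by have := @par_xy F n (mu (s i)); rewrite (negbNE (od (s i))).
Qed.

(** The increasing enumeration of the even basis vectors except the j-th. *)
Definition evenidx (j : 'I_n.+1) : idx n := [ffun i => inord (2 * lift j i)].

Lemma evenidxE j i : evenidx j i = (2 * bump j i)%N :> nat.
Proof. by rewrite ffunE inordK //; have := ltn_ord (lift j i); rewrite /= ; lia. Qed.

Lemma injective_even_perm k : injective k -> (forall i, ~~ odd (k i)) ->
  exists j (s : 'S_n), k = [ffun i => evenidx j (s i)].
Proof.
move=> kI kev.
have lt i : ((k i)./2 < n.+1)%N.
  by have := ltn_ord (k i); have := odd_double_half (k i); lia.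
pose h i := Ordinal (lt i).
have kE i : k i = (2 * h i)%N :> nat.
  by have := odd_double_half (k i); rewrite (negbTE (kev i)) /=; lia.
have hI : injective h.
  by move=> i j e; apply/kI/val_inj; rewrite /= !kE e.
have [j jh] : exists j, j \notin codom h.
  apply/existsP; rewrite -negb_forall; apply/negP => /forallP all.
  have : (#|'I_n.+1| <= #|codom h|)%N by apply/subset_leq_card/subsetP => x _; apply: all.
  by rewrite card_codom // !card_ord ltnn.
have ex i : exists q : 'I_n, h i == lift j q.
  have ne : j != h i by apply: contra jh => /eqP ->; apply: codom_f.
  by have [l e _] := unlift_some ne; exists l; rewrite e.
pose g i := xchoose (ex i).
have gE i : h i = lift j (g i) by apply/eqP; apply: xchooseP (ex i).
have gI : injective g by move=> i i' e; apply: hI; rewrite !gE e.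
exists j, (perm gI); apply/ffunP => i; apply: val_inj.
by rewrite /= [in RHS]ffunE permE evenidxE kE gE.
Qed.

(** Lower the first [j] odd basis vectors and raise the others: this is the only
    way to reach all even basis vectors other than the j-th one by steps of 1. *)
Definition lowers (j : 'I_n.+1) (i : 'I_n) : nat * nat :=
  if (i < j)%N then (0, 1)%N else (1, 0)%N.

Lemma xy_lowers j i (a b : 'I_(2 * n).+1) : xy_mx (lowers j i) a b =
  if (i < j)%N then Y a b else X a b.
Proof.
by rewrite /xy_mx /lowers; case: ltnP => _ /=; rewrite expr0 expr1 ?mul1r ?mulr1.
Qed.

(** By injectivity of [r]: upwards induction below [j], downwards induction from
    [j] on. *)
Lemma step_perm_id (j : nat) (r : 'S_n) :
  (forall i : 'I_n, if (i < j)%N then (r i <= i)%N else (i <= r i)%N) ->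
  r = 1%g.
Proof.
move=> ri; apply/permP => i; rewrite perm1.
have [lt|ge] := ltnP i j.
  have [m im] := ubnP (i : nat); elim: m i im lt => // m IH i im lt.
  have := ri i; rewrite lt leq_eqVlt => /predU1P[/val_inj //|lt'].
  have := IH (r i) (leq_trans lt' im) (ltn_trans lt' lt).
  by move/perm_inj => e; rewrite e in lt'; rewrite ltnn in lt'.
have [m im] := ubnP (n - i); elim: m i im ge => // m IH i im ge.
have := ri i; rewrite ltnNge ge /= leq_eqVlt => /predU1P[/esym/val_inj //|lt'].
have e : r (r i) = r i.
  apply: IH; last exact: leq_trans ge (ltnW lt').
  by have := ltn_ord (r i); lia.
by move/perm_inj: e => e; rewrite e ltnn in lt'.
Qed.

Lemma lowers_entry j j' (s : 'S_n) (i l : 'I_n) :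
  xy_mx (lowers j (s i)) (evenidx j' i) (oddidx l) =
  if (s i < j)%N then (bump j' i == l)%:R * weight F n (2 * l).+1
  else (bump j' i == l.+1)%:R.
Proof.
rewrite xy_lowers; case: ifP => _; rewrite mxE evenidxE oddidxE.
  by rewrite eqSS eqn_mul2l.
by rewrite -(mulnS 2 l : _ = (2 * l).+2) eqn_mul2l.
Qed.

Lemma tens_lowers j j' (s : 'S_n) :
  tens (fun i => xy_mx (lowers j (s i))) vac (evenidx j') =
  \prod_(i < n) if (s i < j)%N then (i < j')%:R * weight F n (2 * i).+1
                else (j' <= i)%:R.
Proof.
rewrite tens_vac /determinant (bigD1 1%g) //= odd_perm1 expr0 mul1r.
rewrite [X in _ + X]big1 ?addr0 => [|r r1].
  apply: eq_bigr => i _; rewrite mxE perm1 lowers_entry.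
  have -> : (bump j' i == i) = (i < j')%N by rewrite /bump; lia.
  by have -> : (bump j' i == i.+1) = (j' <= i)%N by rewrite /bump; lia.
apply/eqP; rewrite mulf_eq0; apply/orP; right; apply: contraNT r1 => nz.
(* A nonzero term of the determinant moves each basis vector by one step. *)
apply/eqP/(@step_perm_id j') => i.
have /prodf_neq0/(_ i isT) := nz; rewrite mxE lowers_entry /bump.
have := ltn_ord i; case: (leqP j' i) => ij; case: ifP => _ _ /=;
  rewrite ?add1n ?add0n ?mulf_eq0 ?negb_or ?pnatr_eq0 ?eqb0 ?negbK.
- by case/andP=> /eqP <-.
- by case/eqP=> ->.
- by case/andP=> /eqP <-.
- by move/eqP=> ->.
Qed.

Lemma card_below (j : 'I_n.+1) : (\sum_(i < n | i < j) 1 = j)%N.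
Proof. by rewrite -(big_ord_widen n (fun=> 1%N)) ?sum1_card ?card_ord // -ltnS. Qed.

(** The orbit sums of the patterns [lowers j] are, up to nonzero scalars, dual to
    the multi-indices [evenidx j]. *)
Lemma orbit_lowers_evenidx j : exists2 c : F, c != 0 &
  forall j', Phi (orbit_sum F (lowers j)) (evenidx j') = (j == j')%:R * c.
Proof.
pose fit j' (s : 'S_n) := [forall i : 'I_n, (s i < j)%N == (i < j')%N].
pose c := \prod_(i < n) if (i < j)%N then weight F n (2 * i).+1 else 1.
exists (c *+ #|fit j|).
  rewrite mulrn_eq0 negb_or -lt0n; apply/andP; split.
    by apply/card_gt0P; exists 1%g; apply/forallP => i; rewrite perm1.
  apply/prodf_neq0 => i _; case: ifP => _; last exact: oner_neq0.
  by apply: weight_neq0; have := ltn_ord i; lia.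
move=> j'; rewrite Phi_orbit_sum sum_ffunE.
under eq_bigr do rewrite tens_lowers.
rewrite (bigID (fit j')) /= [X in _ + X]big1 ?addr0 => [|s]; last first.
  rewrite negb_forall => /existsP[i ne]; rewrite (bigD1 i) //=.
  by case: (leqP j' i) ne; case: ifP => //= _ _ _; rewrite ?mul0r.
have [<-|ne] := eqVneq j j'; last first.
  rewrite mul0r big_pred0 // => s; apply: contraNF ne => /forallP e.
  apply/eqP/val_inj; rewrite /= -[in LHS](card_below j) -[in RHS](card_below j').
  rewrite (reindex_inj (@perm_inj _ s)) /=; apply: eq_bigl => i; exact: (eqP (e i)).
rewrite mul1r -sumr_const; apply: eq_bigr => s /forallP e.
apply: eq_bigr => i _; rewrite (eqP (e i)).
by case: ltnP => _; rewrite ?mul1r.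
Qed.

Lemma filt_sumX (I : Type) (r : seq I) (f : I -> R) d :
  (forall i, (msize (f i) <= d)%N) -> filt d (Phi (\sum_(i <- r) f i)).
Proof.
by move=> h; rewrite (linear_sum Phi); apply: filt_sum => i _; exists (f i).
Qed.

(** An alternating tensor supported on even multi-indices is determined by its
    values at the [evenidx j], hence is a combination of the images of n+1
    polynomials of degree n. *)
Lemma even_alternating_filt u : alternating u ->
  (forall k i, odd (k i) -> u k = 0) -> filt n.+1 u.
Proof.
move=> au eu; have [c cP] : exists c : 'I_n.+1 -> F, forall j, c j != 0 /\
    forall j', Phi (orbit_sum F (lowers j)) (evenidx j') = (j == j')%:R * c j.
  apply: (@fin_all_exists _ (fun=> F) (fun j cj => cj != 0 /\ forall j',
    Phi (orbit_sum F (lowers j)) (evenidx j') = (j == j')%:R * cj)) => j.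
  by have [c c0 e] := orbit_lowers_evenidx j; exists c.
have -> : u = \sum_j (u (evenidx j) / c j) *: Phi (orbit_sum F (lowers j)).
  apply: alternating_eq => // [k s|k kI].
    rewrite !sum_ffunE mulr_sumr; apply: eq_bigr => j _.
    by rewrite !tscaleE orbit_sum_alternating mulrCA.
  rewrite sum_ffunE; under eq_bigr do rewrite tscaleE.
  have [/existsP[i ki]|] := boolP [exists i, odd (k i)].
    rewrite (eu _ _ ki) big1 // => j _; rewrite (orbit_sum_even _ ki) ?mulr0 // => l.
    by rewrite /lowers; case: ifP.
  rewrite negb_exists => /forallP kev.
  have [j [s ->]] := injective_even_perm kI kev.
  rewrite au (bigD1 j) //= orbit_sum_alternating (proj2 (cP j)) eqxx mul1r.
  rewrite mulrCA divfK ?(proj1 (cP j)) // big1 ?addr0 // => l lj.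
  by rewrite orbit_sum_alternating (proj2 (cP l)) (negPf lj) mul0r !mulr0.
apply: filt_sum => j _; apply: filtZ; apply: filt_sumX => s.
rewrite mono_mexp msizeX mdeg_mexp ltnS -[X in (_ <= X)%N]card_ord -sum1_card.
by apply: leq_sum => i _; rewrite /lowers /=; case: ifP.
Qed.

(** Consequently the image of a semi-invariant of any degree is already the image
    of a polynomial of degree at most n. *)
Lemma orbit_sum_filt mu : (forall i, ~~ even_pair (mu i)) ->
  filt n.+1 (Phi (orbit_sum F mu)).
Proof.
move=> od; apply: even_alternating_filt; first exact: orbit_sum_alternating.
by move=> k i; apply: orbit_sum_even.
Qed.

Definition reached u := exists d, filt d u.

Lemma reachedD u w : reached u -> reached w -> reached (u + w).
Proof.
move=> [d du] [e ew]; exists (maxn d e).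
by apply: filtD; [apply: filt_le du | apply: filt_le ew]; rewrite leq_max leqnn ?orbT.
Qed.

Lemma reachedZ a u : reached u -> reached (a *: u).
Proof. by move=> [d du]; exists d; apply: filtZ. Qed.

(** The matrices [N] whose action on any factor preserves the vectors reached from
    [vac] form an algebra that contains X and Y; the aim is to show that it
    contains the elementary matrices. *)
Definition transporting (N : M) := forall i u, reached u -> reached (slot i N u).

Lemma transportingM N N' : transporting N -> transporting N' -> transporting (N * N').
Proof. by move=> gN gN' i u ru; rewrite slotM; apply/gN/gN'. Qed.

Lemma transportingZ a N : a != 0 -> transporting (a *: N) -> transporting N.
Proof.
move=> a0 gN i u ru; rewrite -[slot i N u]scale1r -(mulVf a0) -scalerA -slotZ.
exact/reachedZ/gN.
Qed.

Lemma transporting1 : transporting 1.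
Proof.
move=> i u; rewrite /slot (_ : tens _ u = u) // -[RHS]tens1; apply: eq_tens => j.
by rewrite /slot_family; case: ifP.
Qed.

Lemma transportingX N t : transporting N -> transporting (N ^+ t).
Proof.
move=> gN; elim: t => [|t IH]; first by rewrite expr0; apply: transporting1.
by rewrite exprS; apply: transportingM.
Qed.

Lemma transporting_raising : transporting X.
Proof.
move=> i u [d du]; exists d.+1.
by have := act_filt (lshift n i) du; rewrite /act (unsplitK (inl i)).
Qed.

Lemma transporting_lowering : transporting Y.
Proof.
move=> i u [d du]; exists d.+1.
by have := act_filt (rshift n i) du; rewrite /act (unsplitK (inr i)).
Qed.

Lemma raising_exp t : X ^+ t = \matrix_(i, j) (i == (j + t)%N :> nat)%:R.
Proof.
elim: t => [|t IH].
  by apply/matrixP => i j; rewrite expr0 !mxE addn0.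
rewrite exprS IH; apply/matrixP => i j; rewrite !mxE.
have [i0|i0] := posnP i.
  rewrite i0 addnS big1 // => l _; rewrite mxE i0 mul0r //.
have lt : (i.-1 < (2 * n).+1)%N by have := ltn_ord i; lia.
rewrite (bigD1 (Ordinal lt)) //= !mxE /= prednK // eqxx mul1r big1 ?addr0.
  by congr (_%:R); congr nat_of_bool; lia.
move=> l; rewrite -val_eqE /= => ne; rewrite !mxE.
by rewrite (_ : (i == l.+1 :> nat) = false) ?mul0r //; lia.
Qed.

(** X^(2n) is an elementary matrix; multiplying it by Y on either side gives the
    other ones, since the weights do not vanish. *)
Lemma transporting_corner : transporting (delta_mx ord_max ord0).
Proof.
suff -> : delta_mx ord_max ord0 = X ^+ (2 * n).
  exact: (transportingX _ transporting_raising).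
apply/matrixP => i j; rewrite raising_exp !mxE; congr (_%:R); congr nat_of_bool.
by rewrite -!val_eqE /=; have := ltn_ord i; have := ltn_ord j; lia.
Qed.

Lemma lowering_delta (a a' b : 'I_(2 * n).+1) : a' = a.+1 :> nat ->
  Y * delta_mx a' b = weight F n a' *: delta_mx a b.
Proof.
move=> e; apply/matrixP => i j; rewrite !mxE (bigD1 a') //= !mxE eqxx /=.
rewrite big1 ?addr0 => [|l /negPf ne]; last by rewrite !mxE ne mulr0.
by rewrite e eqSS val_eqE mulrAC mulrC -natrM mulnb.
Qed.

Lemma delta_lowering (a b b' : 'I_(2 * n).+1) : b' = b.+1 :> nat ->
  delta_mx a b * Y = weight F n b' *: delta_mx a b'.
Proof.
move=> e; apply/matrixP => i j; rewrite !mxE (bigD1 b) //= !mxE eqxx andbT.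
rewrite big1 ?addr0 => [|l /negPf ne]; last by rewrite !mxE ne andbF mul0r.
have -> : (b.+1 == j :> nat) = (j == b') by rewrite -val_eqE /= e eq_sym.
by case: (j =P b') => [->|_]; rewrite ?andbT ?andbF ?mul1r ?mul0r ?mulr0 // mulrC.
Qed.

Lemma transporting_delta (a b : 'I_(2 * n).+1) : transporting (delta_mx a b).
Proof.
have col0 c : transporting (delta_mx c ord0).
  have [m cm] := ubnP (2 * n - c); elim: m c cm => // m IH c cm.
  have [lt|ge] := ltnP c (2 * n); last first.
    suff -> : c = ord_max by apply: transporting_corner.
    by apply: val_inj => /=; have := ltn_ord c; lia.
  pose c' : 'I_(2 * n).+1 := Ordinal (lt : c.+1 < (2 * n).+1)%N.
  have gc' : transporting (delta_mx c' ord0) by apply: IH => /=; lia.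
  apply: (@transportingZ (weight F n c')); first by apply: weight_neq0.
  rewrite -lowering_delta //; apply: transportingM => //.
  exact: transporting_lowering.
have [m bm] := ubnP (b : nat); elim: m b bm => // m IH b bm.
have [b0|b0] := posnP b; first by rewrite (_ : b = ord0) //; apply: val_inj.
have lt : (b.-1 < (2 * n).+1)%N by have := ltn_ord b; lia.
have gb : transporting (delta_mx a (Ordinal lt)) by apply: IH => /=; lia.
apply: (@transportingZ (weight F n b)).
  by apply: weight_neq0; have := ltn_ord b; lia.
rewrite -(@delta_lowering _ (Ordinal lt)) /= ?prednK //.
by apply: transportingM => //; apply: transporting_lowering.
Qed.

Lemma reached_tens A u : (forall i, transporting (A i)) -> reached u ->
  reached (tens A u).
Proof.
move=> gA ru.
have step (r : seq 'I_n) : uniq r ->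
    reached (tens (fun i => if i \in r then A i else 1) u).
  elim: r => [_|i r IH /= /andP[ir /IH rr]]; first by rewrite tens1.
  suff -> : tens (fun j => if j \in i :: r then A j else 1) u
      = slot i (A i) (tens (fun j => if j \in r then A j else 1) u) by apply: gA.
  rewrite /slot tensM; apply: eq_tens => j; rewrite inE /slot_family.
  by case: eqP => [->|_]; rewrite ?(negPf ir) ?mulr1 ?mul1r.
have := step _ (enum_uniq 'I_n); congr reached; apply: eq_tens => i.
by rewrite mem_enum.
Qed.

Lemma Phi_surjective u : exists p, u = Phi p.
Proof.
suff [d [p _ ->]] : reached u by exists p.
pose e k := tens (fun i => delta_mx (k i) (oddidx i)) vac.
have eE k l : e k l = (l == k)%:R.
  rewrite tens_vac; have [->|ne] := eqVneq l k.
    rewrite (_ : (\matrix_(i, j) _) = 1%:M) ?det1 //; apply/matrixP => i j.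
    rewrite !mxE eqxx /= -!val_eqE /= !oddidxE eqSS eqn_mul2l /=.
    by rewrite eq_sym val_eqE.
  have [i li] : exists i, l i != k i.
    apply/existsP; apply: contraNT ne; rewrite negb_exists => /forallP h.
    by apply/eqP/ffunP => i; have := h i; rewrite negbK => /eqP.
  by rewrite (expand_det_row _ i) big1 // => j _; rewrite !mxE (negPf li) mul0r.
have -> : u = \sum_k u k *: e k.
  apply/ffunP => l; rewrite sum_ffunE (bigD1 l) //= big1 ?addr0 => [|k /negPf ne].
    by rewrite tscaleE eE eqxx mulr1.
  by rewrite tscaleE eE eq_sym ne mulr0.
elim/big_ind: _ => [||k _]; first by exists 0%N; apply: filt0.
  exact: reachedD.
apply: reachedZ; apply: reached_tens; first by move=> i; apply: transporting_delta.
by exists 1%N; rewrite -Phi1; exists 1 => //; rewrite msize1.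
Qed.

Lemma dim_tspace : \dim {:tspace F n} = ((2 * n + 1) ^ n)%N.
Proof.
by rewrite dimvf /= /dim /= muln1 card_ffun !card_ord addn1.
Qed.

End Generation.

(** * Linear forms that vanish on the ideal *)

Section CurveInvariants.
Variable F : numFieldType.
Local Notation C := {mpoly F[36]}.
Implicit Types (nu mu : nat * nat) (G H : C).

(** The 36 variables are the coefficients of x^s y^t, for s, t < 6, in a
    polynomial f; in the sequel only the total degrees 1, 3 and 5 occur. *)
Definition in_grid nu := (nu.1 < 6)%N && (nu.2 < 6)%N.
Definition var_index nu : 'I_36 := inord (6 * nu.1 + nu.2).
Definition coef nu : C := if in_grid nu then 'X_(var_index nu) else 0.
Definition pder nu G : C := if in_grid nu then G^`M(var_index nu) else 0.
Definition shift mu nu := (mu.1 + nu.1, mu.2 + nu.2)%N.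
Definition cell (p : 'I_6 * 'I_6) : nat * nat := (p.1 : nat, p.2 : nat).
(** The derivative of a function [G] of f along f |-> x^s y^t f, for [nu = (s, t)];
    on the coordinate functions it subtracts [nu] from the index. *)
Definition mul_der nu G : C := \sum_p coef (cell p) * pder (shift (cell p) nu) G.

Lemma var_indexE nu : in_grid nu -> var_index nu = (6 * nu.1 + nu.2)%N :> nat.
Proof. by case/andP=> a b; rewrite inordK //; lia. Qed.

Lemma var_index_inj nu mu : in_grid nu -> in_grid mu ->
  (var_index nu == var_index mu) = (nu == mu).
Proof.
move=> gn gm; rewrite -val_eqE /= !var_indexE // -pair_eqE /=.
by move: gn gm; rewrite /in_grid; case: nu mu => a b [c d] /= ; lia.
Qed.

Lemma pder_is_linear nu : linear (pder nu).
Proof.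
move=> a G H; rewrite /pder; case: ifP => _; first exact: mderiv_is_linear.
by rewrite scaler0 addr0.
Qed.

HB.instance Definition _ nu :=
  GRing.isLinear.Build F C C _ (pder nu) (pder_is_linear nu).

Lemma pderM nu G H : pder nu (G * H) = pder nu G * H + G * pder nu H.
Proof.
by rewrite /pder; case: ifP => _; rewrite ?mderivM // mul0r mulr0 addr0.
Qed.

Lemma pderC nu mu G : pder nu (pder mu G) = pder mu (pder nu G).
Proof.
rewrite /pder; case: ifP => _; case: ifP => _ //; first exact: mderiv_comm.
  exact: mderiv0.
by rewrite mderiv0.
Qed.

Lemma pder_coef nu mu : pder nu (coef mu) = (in_grid nu && (nu == mu))%:R.
Proof.
rewrite /pder /coef; case: ifP => //= gn; case: ifP => gm.
  rewrite mderivX mnm1E eq_sym var_index_inj //.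
  have z (m : 'X_{1..36}) : (m - m)%MM = 0%MM.
    by apply/mnmP => i; rewrite mnmBE subnn mnm0E.
  by case: eqP => [->|_]; rewrite ?scale0r // scale1r z mpolyX0.
by rewrite mderiv0; case: eqP => // e; rewrite e gm in gn.
Qed.

Lemma mul_der_is_linear nu : linear (mul_der nu).
Proof.
move=> a G H; rewrite /mul_der scaler_sumr -big_split; apply: eq_bigr => p _ /=.
by rewrite linearP mulrDr -scalerAr.
Qed.

HB.instance Definition _ nu :=
  GRing.isLinear.Build F C C _ (mul_der nu) (mul_der_is_linear nu).

Lemma mul_derM nu G H : mul_der nu (G * H) = mul_der nu G * H + G * mul_der nu H.
Proof.
rewrite /mul_der mulr_suml mulr_sumr -big_split; apply: eq_bigr => p _ /=.
by rewrite pderM mulrDr mulrA mulrCA.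
Qed.

Lemma sum_cell nu (f : nat * nat -> C) : in_grid nu ->
  \sum_p (nu == cell p)%:R * f (cell p) = f nu.
Proof.
case: nu => a b /andP[/= la lb].
rewrite (bigD1 (Ordinal la, Ordinal lb)) //= eqxx mul1r big1 ?addr0 // => -[c d].
move=> ne; rewrite (_ : (_ == _) = false) ?mul0r //; apply: contraNF ne.
by move=> /eqP[ea eb]; apply/eqP; congr (_, _); apply: val_inj.
Qed.

Lemma mul_der_coef nu mu : in_grid mu -> mul_der nu (coef mu) =
  if (nu.1 <= mu.1)%N && (nu.2 <= mu.2)%N then coef (mu.1 - nu.1, mu.2 - nu.2)%N
  else 0.
Proof.
move=> gm; rewrite /mul_der; case: ifP => [/andP[le1 le2]|nle].
  rewrite -[RHS](@sum_cell (mu.1 - nu.1, mu.2 - nu.2)%N); last first.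
    by case/andP: gm => a b; rewrite /in_grid /=; lia.
  apply: eq_bigr => p _; rewrite pder_coef mulrC; congr (_%:R * _).
  congr nat_of_bool; rewrite -!pair_eqE /= /in_grid /=.
  by case/andP: gm => a b; lia.
apply: big1 => p _; rewrite pder_coef; case: eqP => [e|]; last first.
  by rewrite andbF mulr0.
by move: nle; rewrite -e /= !leq_addl.
Qed.

(** The commutation rule on which the duality between multiplication of
    polynomials and [mul_der] rests. *)
Lemma pder_mul_der mu nu G :
  pder mu (mul_der nu G) = mul_der nu (pder mu G) + pder (shift mu nu) G.
Proof.
rewrite /mul_der linear_sum /=.
under eq_bigr do rewrite pderM pder_coef pderC.
rewrite big_split /= addrC; congr (_ + _).
have [gm|gm] := boolP (in_grid mu).
  by rewrite /= (@sum_cell mu (fun q => pder (shift q nu) G)).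
rewrite big1 => [|p _]; last by rewrite mul0r.
rewrite /pder ifN //; apply: contra gm; rewrite /in_grid /=; lia.
Qed.

Section Polarization.
Variable n : nat.
Local Notation R := {mpoly F[n + n]}.
Implicit Types (f : 'I_n -> nat * nat) (r : seq 'I_n).

Definition pders r f G := foldr (fun i => pder (f i)) G r.

Lemma pders_addrow r f nu i G : i \notin r -> pders r (addrow f nu i) G = pders r f G.
Proof.
elim: r => //= j r IH; rewrite inE negb_or => /andP[ij ir].
by rewrite IH // /addrow eq_sym (negPf ij).
Qed.

Lemma pders_mul_der r f nu G : uniq r ->
  pders r f (mul_der nu G) =
  mul_der nu (pders r f G) + \sum_(i <- r) pders r (addrow f nu i) G.
Proof.
elim: r => [_|i r IH /= /andP[ir /IH ->]]; first by rewrite big_nil addr0.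
rewrite (linearD (pder (f i))) /= pder_mul_der (linear_sum (pder (f i))) big_cons.
rewrite -addrA; congr (_ + (_ + _)).
  by rewrite pders_addrow // /addrow eqxx.
rewrite !big_seq; apply: eq_bigr => j jr; rewrite /addrow.
by case: eqP => // e; rewrite e jr in ir.
Qed.

(** The full polarization of [G], as a linear form on R: a monomial with rows
    mu_1, ..., mu_n is sent to the iterated derivative of [G] with respect to the
    coefficients of these monomials, evaluated at 0. *)
Definition polar G : R -> F^o :=
  lin_ext (fun m => (pders (enum 'I_n) (rows m) G)@_0%MM : F^o).

HB.instance Definition _ G := GRing.Linear.on (polar G).

Lemma eq_pders r f f' G : f =1 f' -> pders r f G = pders r f' G.
Proof. by move=> e; elim: r => //= i r ->; rewrite e. Qed.

Lemma polar_mono f G : polar G (mono F f) = (pders (enum 'I_n) f G)@_0%MM.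
Proof.
by rewrite mono_mexp /polar lin_extX (eq_pders _ _ (rows_mexp f)).
Qed.

Lemma mul_der_mcoeff0 nu G : (mul_der nu G)@_0%MM = 0.
Proof.
rewrite /mul_der raddf_sum big1 // => p _; rewrite /= rmorphM /= /coef.
by case: ifP => _; rewrite ?mcoeff0 ?mul0r // mcoeffX mnm1_eq0 mul0r.
Qed.

(** Infinitesimal invariance of [G] under multiplication of f by even series. *)
Definition mul_invariant G :=
  forall nu, even_pair nu -> nu != (0, 0)%N -> mul_der nu G = 0.

Lemma polar_coinv G p : mul_invariant G -> p \in @coinv_ideal F n -> polar G p = 0.
Proof.
move=> inv; elim/coinv_ideal_ind => [|q1 q2 e1 e2|c f nu ev nz].
- exact: linear0.
- by rewrite (linearD (polar G)) /= e1 e2 addr0.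
rewrite (linearZ_LR (polar G)) /= mono_psum (linear_sum (polar G)) /=.
under eq_bigr do rewrite polar_mono.
have /(congr1 (mcoeff 0%MM)) := pders_mul_der f nu G (enum_uniq 'I_n).
rewrite inv // mcoeffD mul_der_mcoeff0 add0r raddf_sum big_enum /= => <-.
rewrite (_ : pders _ _ 0 = 0) ?mcoeff0 ?scaler0 //.
by elim: (enum _) => //= i r ->; rewrite linear0.
Qed.

Definition mvars f : 'X_{1..36} := (\sum_i U_(var_index (f i)))%MM.

Lemma polar_orbit_sum f G : (forall i, in_grid (f i)) ->
  polar G (orbit_sum F f) = G@_(mvars f) *+ (\prod_i (mvars f i)`! * n`!).
Proof.
move=> gf; rewrite (linear_sum (polar G)) mulrnA -card_Sn -sumr_const.
apply: eq_bigr => s _ /=; rewrite polar_mono.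
have -> : pders (enum 'I_n) (f \o s) G = mderivm (mvars f) G.
  have -> : mvars f = (\sum_(i <- enum 'I_n) U_(var_index (f (s i))))%MM.
    by rewrite /mvars (reindex_inj (@perm_inj _ s)) /= big_enum.
  rewrite mderiv_summ; elim: (enum _) => //= i r ->.
  by rewrite mderivmU1m /pder gf.
rewrite mcoeff_mderivm addm0; congr (_ *+ _); apply: eq_bigr => i _.
by rewrite ffactnn.
Qed.

End Polarization.
End CurveInvariants.

(** * Invariants of the germ of an odd plane curve *)

Section Covariants.
Variable F : numFieldType.
Local Notation C := {mpoly F[36]}.
Local Notation c s t := (coef F (s%N, t%N)).
Local Notation a := (c 1 0).
Local Notation b := (c 0 1).

(** The component of degree [d] of f at the tangent vector (b, -a). *)
Definition tangent_form d : C :=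
  \sum_(j < d.+1) b ^+ (d - j) * (- a) ^+ j * c (d - j) (nat_of_ord j).
(** The partial derivatives of the cubic component at the tangent vector. *)
Definition cubic_dx : C :=
  \sum_(j < 3) (3 - j)%:R * b ^+ (2 - j) * (- a) ^+ j * c (3 - j) (nat_of_ord j).
Definition cubic_dy : C :=
  \sum_(j < 3) j.+1%:R * b ^+ (2 - j) * (- a) ^+ j * c (2 - j) j.+1.
(** Solving f (t u + s w) = 0 for s, with u the tangent vector and w a fixed
    vector, gives s = - t^3 f_3(u) / f_1(w)
    + t^5 (f_3(u) (d_w f_3)(u) / f_1(w)^2 - f_5(u) / f_1(w)) + ...; clearing
    denominators in the coefficient of t^5 for w = (1, 0) and w = (0, 1) gives,
    up to sign, the following polynomials of degree 7. *)
Definition jet_x : C := a * tangent_form 5 - tangent_form 3 * cubic_dx.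
Definition jet_y : C := b * tangent_form 5 - tangent_form 3 * cubic_dy.

Lemma mul_der_nat nu k : mul_der nu (k%:R : C) = 0.
Proof.
rewrite (raddfMn (mul_der nu)) /= (_ : mul_der nu 1 = 0) ?mul0rn //.
have := mul_derM nu (1 : C) 1; rewrite !mul1r mulr1 => /eqP.
by rewrite -subr_eq0 opprD addrA subrr sub0r oppr_eq0 => /eqP.
Qed.

Lemma mul_derX nu (G : C) k : mul_der nu (G ^+ k) = G ^+ k.-1 * mul_der nu G *+ k.
Proof.
elim: k => [|k IH]; first by rewrite expr0 (mul_der_nat nu 1) mulr0n.
rewrite exprS mul_derM IH mulrS mulrC; congr (_ + _).
by case: k {IH} => [|k] /=; rewrite ?mulr0n ?mulr0 // mulrnAr mulrA -exprS.
Qed.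

Lemma mul_der_coef_big nu mu : in_grid mu -> (mu.1 + mu.2 < nu.1 + nu.2)%N ->
  mul_der nu (coef F mu) = 0.
Proof. by move=> gm lt; rewrite mul_der_coef // ifF //; lia. Qed.

Lemma mul_invariantM (G H : C) : mul_invariant G -> mul_invariant H ->
  mul_invariant (G * H).
Proof.
by move=> iG iH nu ev nz; rewrite mul_derM iG // iH // mul0r mulr0 addr0.
Qed.

Lemma mul_invariantX (G : C) k : mul_invariant G -> mul_invariant (G ^+ k).
Proof. by move=> iG nu ev nz; rewrite mul_derX iG // mulr0 mul0rn. Qed.

Lemma even_pair_cases (P : nat * nat -> Prop) :
  P (2, 0)%N -> P (1, 1)%N -> P (0, 2)%N ->
  P (4, 0)%N -> P (3, 1)%N -> P (2, 2)%N -> P (1, 3)%N -> P (0, 4)%N ->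
  (forall nu, (5 < nu.1 + nu.2)%N -> P nu) ->
  forall nu, even_pair nu -> nu != (0, 0)%N -> P nu.
Proof.
move=> p20 p11 p02 p40 p31 p22 p13 p04 big [s t].
have [lt|ge] := ltnP 5 (s + t); first by move=> _ _; apply: big.
by case: s ge => [|[|[|[|[|[|s]]]]]]; case: t => [|[|[|[|[|[|t]]]]]].
Qed.

Lemma linear_part_invariant : mul_invariant a /\ mul_invariant b.
Proof.
by split; apply: even_pair_cases; rewrite ?mul_der_coef //= => nu nu5;
   rewrite mul_der_coef_big //=; lia.
Qed.

Lemma mul_derMl nu (G H : C) : mul_der nu G = 0 -> mul_der nu (G * H) = G * mul_der nu H.
Proof. by move=> e; rewrite mul_derM e mul0r add0r. Qed.

Lemma tangent_const i j : mul_invariant (b ^+ i * (- a) ^+ j).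
Proof.
have [ia ib] := linear_part_invariant.
apply: mul_invariantM; apply: mul_invariantX => // nu ev nz.
by rewrite (linearN (mul_der nu)) /= ia // oppr0.
Qed.

(** The value of x^s y^t at the tangent vector, when it has degree 2. *)
Definition tangent_power nu : C :=
  if (nu.1 + nu.2 == 2)%N then b ^+ nu.1 * (- a) ^+ nu.2 else 0.

(** Along f |-> x^s y^t f the cubic component moves by a multiple of f_1, which
    vanishes at the tangent vector, and the quintic component by x^s y^t f_3 if
    s + t = 2 and by a multiple of f_1 if s + t = 4. *)
Lemma mul_der_tangent nu : even_pair nu -> nu != (0, 0)%N ->
  [/\ mul_der nu (tangent_form 3) = 0,
      mul_der nu (tangent_form 5) = tangent_power nu * tangent_form 3,
      mul_der nu cubic_dx = tangent_power nu * a
    & mul_der nu cubic_dy = tangent_power nu * b].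
Proof.
move=> ev nz; have k i j := tangent_const i j ev nz.
have kn r i j : mul_der nu (r%:R * b ^+ i * (- a) ^+ j) = 0.
  by rewrite -mulrA mul_derM k mul_der_nat mul0r mulr0 addr0.
split; [rewrite /tangent_form | rewrite /tangent_form | rewrite /cubic_dx
  | rewrite /cubic_dy]; rewrite [LHS](linear_sum (mul_der nu)) /=;
  under eq_bigr do rewrite mul_derMl ?k //.
all: rewrite /tangent_power !big_ord_recr !big_ord0 /= !(subSS, subn0) {k kn}.
all: move: nu ev nz; apply: even_pair_cases; rewrite ?mul_der_coef //= ?(subSS, subn0); try ring.
all: move=> nu nu5; rewrite !mul_der_coef_big //= ?gtn_eqF ?(ltn_trans _ nu5) //; try lia.
all: ring.
Qed.

Lemma jet_invariant : mul_invariant jet_x /\ mul_invariant jet_y.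
Proof.
have [ia ib] := linear_part_invariant.
split=> nu ev nz; have [d3 d5 dx dy] := mul_der_tangent ev nz.
  rewrite /jet_x (linearB (mul_der nu)) /= (mul_derM nu a) (mul_derM nu (tangent_form 3)).
  by rewrite ia // d3 d5 dx; ring.
rewrite /jet_y (linearB (mul_der nu)) /= (mul_derM nu b) (mul_derM nu (tangent_form 3)).
by rewrite ib // d3 d5 dy; ring.
Qed.

Lemma tangent_cubic_invariant : mul_invariant (tangent_form 3).
Proof. by move=> nu ev nz; have [] := mul_der_tangent ev nz. Qed.

End Covariants.

(** * The invariants dual to the test polynomials *)

Section TestMonomials.
Variable F : numFieldType.
Local Notation C := {mpoly F[36]}.
Local Notation c s t := (coef F (s, t)).
Local Notation a := (c 1 0).
Local Notation b := (c 0 1).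

(** Restriction to the curves a x + b y + p x^3 + q x^5; on these the invariants
    become almost monomials. *)
Definition main_var (i : 'I_36) :=
  i \in [:: var_index (1, 0); var_index (0, 1); var_index (3, 0); var_index (5, 0)]%N.
Definition restr : C -> C :=
  comp_mpoly [tuple if main_var i then 'X_i else 0 | i < 36].

HB.instance Definition _ := GRing.RMorphism.on restr.

Lemma mcoeff_restr (G : C) (m : 'X_{1..36}) :
  (forall i, m i != 0%N -> main_var i) -> (restr G)@_m = G@_m.
Proof.
move=> hm; rewrite {2}[G]mpolyE /restr comp_mpolyEX !raddf_sum /=.
apply: eq_bigr => m' _; rewrite !mcoeffZ; congr (_ * _).
rewrite comp_mpolyX; have [/forallP h|] := boolP [forall i, (m' i != 0%N) ==> main_var i].
  rewrite mpolyXE_id; congr (mcoeff _ _); apply: eq_bigr => i _.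
  rewrite tnth_mktuple; case: ifP => // mi.
  by have := h i; rewrite mi implybF negbK => /eqP ->; rewrite !expr0.
rewrite negb_forall => /existsP[i /[!negb_imply] /andP[m'i mi]].
rewrite (bigD1 i) //= tnth_mktuple (negPf mi) expr0n (negPf m'i) mul0r mcoeff0.
rewrite mcoeffX; case: eqP => // e; rewrite e in m'i.
by rewrite (hm _ m'i) in mi.
Qed.

Lemma restr_coef (nu : nat * nat) : in_grid nu -> restr (coef F nu) =
  if nu \in [:: (1, 0); (0, 1); (3, 0); (5, 0)]%N then coef F nu else 0.
Proof.
move=> gn; rewrite /restr /coef gn comp_mpolyXU -tnth_nth tnth_mktuple /main_var.
by rewrite !inE !var_index_inj.
Qed.

Lemma restr_tangent d : (d == 3) || (d == 5) ->
  restr (tangent_form F d) = b ^+ d * c d 0.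
Proof.
move=> d35; rewrite /tangent_form (rmorph_sum restr) /= big_ord_recl /=.
rewrite big1 => [|j _].
  rewrite subn0 expr0 mulr1 addr0 (rmorphM restr) (rmorphXn restr) /=.
  by rewrite !restr_coef //; case/orP: d35 => /eqP ->.
rewrite !(rmorphM restr) /= [restr (coef _ _)]restr_coef /=.
  by rewrite ifN ?mulr0 // !inE -!pair_eqE /= /bump; have := ltn_ord j; lia.
by rewrite /in_grid /= /bump; have := ltn_ord j; lia.
Qed.

Lemma restr_jet_y : restr (jet_y F) = b ^+ 6 * c 5 0.
Proof.
rewrite /jet_y (rmorphB restr) !(rmorphM restr) /= !restr_tangent //.
rewrite (_ : restr (cubic_dy F) = 0); first by rewrite restr_coef //=; ring.
rewrite /cubic_dy (rmorph_sum restr) big1 // => j _.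
rewrite !(rmorphM restr) /= [restr (coef _ (_, _.+1))]restr_coef.
  by rewrite ifN ?mulr0 // !inE -!pair_eqE /=; have := ltn_ord j; lia.
by rewrite /in_grid /=; have := ltn_ord j; lia.
Qed.

Lemma restr_jet_x :
  restr (jet_x F) = a * b ^+ 5 * c 5 0 - 3%:R * b ^+ 5 * c 3 0 ^+ 2.
Proof.
rewrite /jet_x (rmorphB restr) !(rmorphM restr) /= !restr_tangent //.
rewrite (_ : restr (cubic_dx F) = 3%:R * b ^+ 2 * c 3 0).
  by rewrite restr_coef //=; ring.
rewrite /cubic_dx (rmorph_sum restr) /= big_ord_recl /= !subn0 expr0 mulr1.
rewrite big1 ?addr0 => [|j _].
  by rewrite 2!(rmorphM restr) (rmorphXn restr) (rmorph_nat restr) /= !restr_coef.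
rewrite !(rmorphM restr) /= [restr (coef _ _)]restr_coef /=.
  by rewrite ifN ?mulr0 // !inE -!pair_eqE /= /bump; have := ltn_ord j; lia.
by rewrite /in_grid /= /bump; have := ltn_ord j; lia.
Qed.

Definition tmon (A k j l : nat) : 'X_{1..36} :=
  (U_(var_index (1, 0)%N) *+ A + U_(var_index (0, 1)%N) *+ k
   + U_(var_index (3, 0)%N) *+ j + U_(var_index (5, 0)%N) *+ l)%MM.

Lemma tmonE A k j l nu : in_grid nu -> tmon A k j l (var_index nu) =
  ((nu == (1, 0)) * A + (nu == (0, 1)) * k + (nu == (3, 0)) * j + (nu == (5, 0)) * l)%N.
Proof.
move=> gn; rewrite /tmon !mnmDE !mulmnE !mnm1E !var_index_inj //.
by rewrite !(eq_sym _ nu) !(mulnC _ A) !(mulnC _ k) !(mulnC _ j) !(mulnC _ l).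
Qed.

Lemma tmon_eq A k j l A' k' j' l' : (tmon A k j l == tmon A' k' j' l') =
  [&& A == A', k == k', j == j' & l == l'].
Proof.
apply/eqP/and4P => [e|[/eqP -> /eqP -> /eqP -> /eqP ->] //].
have h nu : in_grid nu -> tmon A k j l (var_index nu) = tmon A' k' j' l' (var_index nu).
  by rewrite e.
have := h (1, 0)%N isT; have := h (0, 1)%N isT.
have := h (3, 0)%N isT; have := h (5, 0)%N isT.
by rewrite !tmonE //= !mul0n !mul1n !addn0 !add0n => -> -> -> ->.
Qed.

Lemma tmon_main A k j l i : tmon A k j l i != 0%N -> main_var i.
Proof.
rewrite /tmon /main_var !inE !mnmDE !mulmnE !mnm1E !(eq_sym (var_index _) i).
by do 4!case: (i == _) => //=.
Qed.

Lemma tmonX A k j l :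
  'X_[tmon A k j l] = a ^+ A * b ^+ k * c 3 0 ^+ j * c 5 0 ^+ l :> C.
Proof. by rewrite /tmon !mpolyXD -!mpolyXn. Qed.

(** The index (A, j, l) stands for the exponent pattern with A rows x, j rows x^3,
    l rows x^5, and the remaining [bcount] rows y. *)
Definition test_index := (nat * nat * bool)%type.

Section Index.
Variable n : nat.

Definition valid_test (t : test_index) : bool :=
  let: (A, j, l) := t in
  if l then (4 * j + 7 <= n)%N && (A + 4 * j + 6 <= n)%N
  else (0 < j)%N && (A + 4 * j <= n)%N.

Definition bcount (t : test_index) : nat := let: (A, j, l) := t in (n - A - j - l)%N.

Definition tmonomial (t : test_index) : 'X_{1..36} :=
  let: (A, j, l) := t in tmon A (bcount t) j l.

(** For l = 1 the invariant [jet_y], which restricts to b^6 q, is used when the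
    exponent of b allows it, that is, unless it is the smallest possible one,
    3j + 5; in this last case [jet_x], whose restriction has the leading term
    a b^5 q, takes over. *)
Definition dual_form (t : test_index) : C :=
  let: (A, j, l) := t in
  if ~~ l then a ^+ A * b ^+ (bcount t - 3 * j) * tangent_form F 3 ^+ j
  else if (A + 4 * j + 6 < n)%N then
    a ^+ A * b ^+ (bcount t - 3 * j - 6) * tangent_form F 3 ^+ j * jet_y F
  else a ^+ A.-1 * tangent_form F 3 ^+ j * jet_x F.

Lemma dual_form_invariant t : mul_invariant (dual_form t).
Proof.
have [ia ib] := linear_part_invariant F; have [jx jy] := jet_invariant F.
have ic := tangent_cubic_invariant F; case: t => [[A j] l]; rewrite /dual_form.
by repeat case: ifP => _; repeat apply: mul_invariantM => //; apply: mul_invariantX.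
Qed.

(** The additional term comes from [jet_x].  It has no row x^5 and one row y less
    than three times its number of rows x^3, so that it is not the monomial of a
    valid index. *)
Lemma restr_dual_form t : valid_test t ->
  restr (dual_form t) = 'X_[tmonomial t] \/
  exists A j, restr (dual_form t) =
    'X_[tmonomial t] - 3%:R *: 'X_[tmon A (3 * j - 1) j 0].
Proof.
case: t => [[A j] [|]] /=; last first.
  case/andP=> j0 le; left.
  rewrite !(rmorphM restr) !(rmorphXn restr) /= restr_tangent // !restr_coef //= exprMn -exprM tmonX expr0 mulr1.
  have e : (n - A - j - false = (n - A - j - false - 3 * j) + 3 * j)%N by lia.
  by rewrite [in RHS]e exprD; ring.
case/andP=> le1 le2; case: ifP => lt.
  left; rewrite !(rmorphM restr) !(rmorphXn restr) /= restr_tangent // restr_jet_y !restr_coef //= exprMn -exprM tmonX.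
  set k := (n - A - j - true)%N.
  have e : (k = (k - 3 * j - 6) + 3 * j + 6)%N by rewrite /k; lia.
  by rewrite [in RHS]e !exprD; ring.
right; exists A.-1, (j + 2)%N.
rewrite !(rmorphM restr) !(rmorphXn restr) /= restr_tangent // restr_jet_x !restr_coef //= exprMn -exprM !tmonX.
have -> : (n - A - j - true = 3 * j + 5)%N by lia.
have -> : (3 * (j + 2) - 1 = 3 * j + 5)%N by lia.
have [B ->] : exists B, A = B.+1 by exists A.-1; lia.
by rewrite -mul_mpolyC rmorph_nat /= !exprD !exprS; ring.
Qed.

End Index.
End TestMonomials.

Section Duality.
Variables (F : numFieldType) (n : nat).
Local Notation R := {mpoly F[n + n]}.
Local Notation C := {mpoly F[36]}.

Lemma dual_form_coef t t' : valid_test n t -> valid_test n t' ->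
  (dual_form F n t)@_(tmonomial n t') = (t == t')%:R.
Proof.
move=> it it'; rewrite -mcoeff_restr => [|i]; last first.
  by case: t' {it'} => [[A j] l]; apply: tmon_main.
have e : (tmonomial n t == tmonomial n t') = (t == t').
  case: t t' it it' => [[A j] l] [[A' j'] l'] it it'; rewrite /tmonomial tmon_eq /bcount /=.
  by rewrite -!pair_eqE /= -!pair_eqE /=; case: l it => [] /= it; case: l' it' => /= it'; lia.
case: (restr_dual_form F it) => [->|[A [j ->]]]; rewrite ?mcoeffB mcoeffX e //.
rewrite mcoeffZ mcoeffX (_ : (tmon _ _ _ _ == _) = false) ?mulr0 ?subr0 //.
case: t' {e} it' => [[A' j'] l'] it'; rewrite /tmonomial tmon_eq /bcount /=.
by case: l' it' => /= it'; lia.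
Qed.

Definition test_exponent (t : test_index) (i : 'I_n) : nat * nat :=
  let: (A, j, l) := t in
  if (i < A)%N then (1, 0)%N else if (i < A + bcount n t)%N then (0, 1)%N
  else if (i < A + bcount n t + j)%N then (3, 0)%N else (5, 0)%N.

Lemma test_exponent_grid t i : in_grid (test_exponent t i).
Proof. by case: t => [[A j] l] /=; repeat case: ifP. Qed.

Lemma test_exponent_odd t i : ~~ even_pair (test_exponent t i).
Proof. by case: t => [[A j] l] /=; repeat case: ifP. Qed.

Lemma sum_blocks (m1 m2 m3 m4 : 'X_{1..36}) (A k j l : nat) :
  (\sum_(0 <= i < (A + k + j + l)%N)
     (if (i < A)%N then m1 else if (i < A + k)%N then m2
      else if (i < A + k + j)%N then m3 else m4)
   = m1 *+ A + m2 *+ k + m3 *+ j + m4 *+ l)%MM.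
Proof.
have const u v m : (\sum_(u <= i < v) m = m *+ (v - u) :> 'X_{1..36})%MM.
  by rewrite big_const_nat; elim: (v - u)%N => [|w IH] /=; rewrite ?mulm0n // mulmS IH.
rewrite (@big_cat_nat _ _ _ (A + k + j)) /= ?leq_addr //.
rewrite (@big_cat_nat _ _ _ (A + k)) /= ?leq_addr //.
rewrite (@big_cat_nat _ _ _ A) /= ?leq_addr //.
have add4 (u1 u2 u3 u4 v1 v2 v3 v4 : 'X_{1..36}) : u1 = v1 -> u2 = v2 ->
    u3 = v3 -> u4 = v4 -> (u1 + u2 + u3 + u4 = v1 + v2 + v3 + v4)%MM.
  by move=> -> -> -> ->.
apply: add4.
- rewrite -[in RHS](subn0 A) -const; apply: eq_big_nat => i /andP[_ lt].
  by rewrite lt.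
- rewrite -[in RHS](addKn A k) -const; apply: eq_big_nat => i /andP[ge lt].
  by rewrite ltnNge ge lt.
- rewrite -[in RHS](addKn (A + k) j) -const; apply: eq_big_nat => i /andP[ge lt].
  have /negPf -> : ~~ (i < A)%N by lia.
  have /negPf -> : ~~ (i < A + k)%N by lia.
  by rewrite lt.
- rewrite -[in RHS](addKn (A + k + j) l) -const; apply: eq_big_nat => i /andP[ge lt].
  have /negPf -> : ~~ (i < A)%N by lia.
  have /negPf -> : ~~ (i < A + k)%N by lia.
  by have /negPf -> : ~~ (i < A + k + j)%N by lia.
Qed.

Lemma mvars_test_exponent t : valid_test n t -> mvars (test_exponent t) = tmonomial n t.
Proof.
case: t => [[A j] l] it.
have en : n = (A + bcount n (A, j, l) + j + l)%N.
  by case: l it; rewrite /bcount /=; lia.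
rewrite /tmonomial /tmon -sum_blocks -en big_mkord; apply: eq_bigr => i _ /=.
by repeat case: ifP.
Qed.

(** The semi-invariants that account for the excess. *)
Definition test_poly (t : test_index) : R := orbit_sum F (test_exponent t).

Lemma polar_test_poly t t' : valid_test n t -> valid_test n t' ->
  (@polar F n (dual_form F n t) (test_poly t') == 0) = (t != t').
Proof.
move=> it it'; rewrite polar_orbit_sum; last exact: test_exponent_grid.
rewrite mvars_test_exponent // dual_form_coef // -[_ *+ _]mulr_natr mulf_eq0.
rewrite !pnatr_eq0 eqb0 [X in _ || X]gtn_eqF ?orbF //.
by rewrite muln_gt0 fact_gt0 andbT prodn_gt0 // => i; apply: fact_gt0.
Qed.

Lemma test_poly_indep (s : seq test_index) (c : nat -> F) :
  uniq s -> all (valid_test n) s ->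
  \sum_(i < size s) c i *: test_poly (nth (0, 0, false)%N s i) \in @coinv_ideal F n ->
  forall i, (i < size s)%N -> c i = 0.
Proof.
move=> us /all_nthP -/(_ (0, 0, false)%N) is_ sI i lt.
have := polar_coinv (dual_form_invariant F n (nth (0, 0, false)%N s i)) sI.
rewrite (linear_sum (@polar F n _)) (bigD1 (Ordinal lt)) //= (linearZ_LR (@polar F n _)) /=.
rewrite big1 ?addr0 => [|j ne]; last first.
  rewrite (linearZ_LR (@polar F n _)) /=.
  have /eqP -> : @polar F n (dual_form F n (nth (0, 0, false)%N s i))
      (test_poly (nth (0, 0, false)%N s j)) == 0.
    rewrite polar_test_poly ?is_ // nth_uniq // eq_sym.
    by apply: contra ne => /eqP e; apply/eqP/val_inj.
  by rewrite scaler0.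
move/eqP; rewrite scaler_eq0 polar_test_poly ?is_ // eqxx orbF.
by move/eqP.
Qed.

End Duality.

(** * The dimension of the coinvariant ring *)

Section LowerBound.
Variables (F : numFieldType) (n : nat).
Hypothesis n_gt0 : (0 < n)%N.
Local Notation R := {mpoly F[n + n]}.
Local Notation V := (coinv_ring F n).
Local Notation Phi := (@Phi F n).
Local Notation hcomp d := (pihomog (R := F) mdeg d).

Definition proj (p : R) : V := \pi_V%qT p.

Lemma proj_is_linear : linear proj.
Proof. by move=> a p q; rewrite /proj rmorphD -pi_coinv_ringZ. Qed.

HB.instance Definition _ := GRing.isLinear.Build F R V _ proj proj_is_linear.

Lemma proj_eq0 p : (proj p == 0) = (p \in @coinv_ideal F n).
Proof. 
by rewrite /proj -[p in RHS]subr0 Quotient.idealrBE; congr (_ == _); rewrite rmorph0.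
Qed.

Lemma mono_homog (f : 'I_n -> nat * nat) :
  mono F f \is (\sum_i ((f i).1 + (f i).2))%N.-homog.
Proof. by rewrite mono_mexp dhomogX /= mdeg_mexp. Qed.

Lemma orbit_sum_homog (f : 'I_n -> nat * nat) :
  orbit_sum F f \is (\sum_i ((f i).1 + (f i).2))%N.-homog.
Proof.
apply: rpred_sum => s _; rewrite (reindex_inj (@perm_inj _ s)); exact: mono_homog.
Qed.

Lemma psum_homog nu : psum F n nu \is (nu.1 + nu.2)%N.-homog.
Proof.
apply: rpred_sum => i _; rewrite /xmon !mpolyXn -mpolyXD dhomogX /=.
by rewrite mdegD !mdegMn !mdeg1 !mul1n.
Qed.

Definition test_degree (t : test_index) : nat :=
  (\sum_i ((test_exponent (n := n) t i).1 + (test_exponent (n := n) t i).2))%N.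

Lemma test_degree_gt t : valid_test n t -> (n < test_degree t)%N.
Proof.
move=> it; have lt : (n.-1 < n)%N by rewrite prednK.
have ge1 i : (1 <= (test_exponent (n := n) t i).1 + (test_exponent (n := n) t i).2)%N.
  by have := test_exponent_odd t i; rewrite /even_pair; case: (_ + _)%N.
rewrite /test_degree (bigD1 (Ordinal lt)) //=.
set u := (_.1 + _)%N; set w := (\sum_(i < n | _) _)%N.
have u2 : (1 < u)%N.
  rewrite {}/u; case: t it {ge1 w} => [[A j] l] it /=.
  have /negPf -> : ~~ (n.-1 < A)%N by case: l it; rewrite /=; lia.
  have /negPf -> : ~~ (n.-1 < A + (n - A - j - l))%N by case: l it; rewrite /=; lia.
  by case: ifP.
suff: (n.-1 <= w)%N by lia.
rewrite -[X in (X <= _)%N]/(n.-1) -[X in X.-1](card_ord n) -(cardC1 (Ordinal lt)).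
by rewrite -sum1_card; apply: leq_sum.
Qed.

(** Homogeneous components of elements of the ideal have images of lower degree,
    since the generators of [coinv_ideal_ind] are homogeneous. *)
Lemma filt_hcomp (q : R) d : q \in @coinv_ideal F n -> filt d (Phi (hcomp d q)).
Proof.
move=> qI; move: q qI d; apply: coinv_ideal_ind => [d|p q hp hq d|c f nu ev nz d].
- by rewrite pihomog0 linear0; apply: filt0.
- by rewrite pihomogD (linearD Phi); apply: filtD.
rewrite linearZ (linearZ_LR Phi) /=; apply: filtZ.
have hom : mono F f * psum F n nu \is (mdeg (mexp f) + (nu.1 + nu.2))%N.-homog.
  by apply: dhomogM; [rewrite mono_mexp dhomogX | apply: psum_homog].
have [<-|ne] := eqVneq (mdeg (mexp f) + (nu.1 + nu.2))%N d.
  by rewrite pihomog_dE // mono_mexp; apply: filt_psum.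
by rewrite (pihomog_ne0 ne hom) linear0; apply: filt0.
Qed.

(** Consider a homogeneous basis of the coinvariant ring made of test polynomials
    and monomials.  Modulo lower degrees the image of a polynomial is a
    combination of images of basis elements of the same degree, and those of the
    test polynomials are themselves of lower degree; so the monomials of the
    basis suffice to span V^(tensor n). *)
Section Span.
Variables (T : seq test_index) (r : seq R).
Hypothesis T_valid : all (valid_test n) T.
Hypothesis r_monomial : forall p, p \in r -> exists m, p = 'X_[m].
Local Notation basis := (map (test_poly F n) T ++ r).
Hypothesis basis_span : forall v, spanned (map proj basis) v.

Let U := <<map Phi r>>%VS.

Lemma filt_in_span d u : filt d u -> u \in U.
Proof.
elim: d u => [u [p]|d IH u [p pd ->]].
  by rewrite leqn0 msize_poly_eq0 => /eqP -> ->; rewrite linear0 mem0v.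
rewrite [p]mpolyE (linear_sum Phi) big_seq; apply: memv_suml => m mp.
rewrite (linearZ_LR Phi); apply: memvZ.
have {pd mp} md : (mdeg m <= d)%N.
  by rewrite -ltnS (leq_trans _ pd) // msize_mdeg_lt.
have low u' : filt (mdeg m) u' -> u' \in U by move/(filt_le md)/IH.
have [c] := basis_span (proj 'X_[m]); rewrite /lin_comb size_map => e.
pose q := 'X_[m] - \sum_(i < size basis) c i *: basis`_i.
have qI : q \in @coinv_ideal F n.
  rewrite -proj_eq0 /q (linearB proj) (linear_sum proj) /= e subr_eq0; apply/eqP.
  by apply: eq_bigr => i _; rewrite (linearZ_LR proj) (nth_map 0).
have -> : 'X_[m] = \sum_(i < size basis) c i *: hcomp (mdeg m) basis`_i
    + hcomp (mdeg m) q.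
  rewrite /q (linearB (hcomp (mdeg m))) (linear_sum (hcomp (mdeg m))) /=.
  under [in X in _ + (_ - X)]eq_bigr do rewrite linearZ /=.
  by rewrite addrC subrK pihomogX eqxx.
rewrite (linearD Phi) (linear_sum Phi); apply: memvD; last first.
  by apply: low; apply: filt_hcomp.
apply: memv_suml => i _; rewrite (linearZ_LR Phi); apply: memvZ.
have : basis`_i \in basis by apply: mem_nth.
rewrite mem_cat => /orP[/mapP[t tT ->]|br].
  have it := allP T_valid _ tT; have hom := orbit_sum_homog (test_exponent t).
  have [ed|ne] := eqVneq (test_degree t) (mdeg m); last first.
    by rewrite (pihomog_ne0 ne hom) linear0 mem0v.
  rewrite -ed (pihomog_dE hom); apply: low; rewrite -ed.
  apply: filt_le (test_degree_gt it) _.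
  exact: (orbit_sum_filt _ (test_exponent_odd t)).
have [m' em'] := r_monomial br; rewrite em' pihomogX; case: ifP => _.
  by apply: memv_span; rewrite -em'; apply: map_f.
by rewrite linear0 mem0v.
Qed.

Lemma span_bound : ((2 * n + 1) ^ n <= size r)%N.
Proof.
rewrite -(dim_tspace F n) -(size_map Phi r).
suff -> : {:tspace F n}%VS = U by apply: dim_span.
apply/vspaceP => u; rewrite memvf; apply/esym.
have [p ->] := Phi_surjective u; apply: (@filt_in_span (msize p)).
by exists p.
Qed.

End Span.

(** A basis of the coinvariant ring is obtained by completing the test polynomials
    with monomials of exponents less than 2n. *)
Lemma lmod_dim_coinv_ring (T : seq test_index) : uniq T -> all (valid_test n) T ->
  ((2 * n + 1) ^ n + size T <= lmod_dim V)%N.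
Proof.
move=> uT iT; pose tp := map (test_poly F n) T.
pose mons : seq R := [seq 'X_[(m : 'X_{1..n + n})] |
  m <- map (fun g : {ffun 'I_(n + n) -> 'I_(2 * n)} =>
     [multinom (g i : nat) | i < n + n]) (enum {ffun 'I_(n + n) -> 'I_(2 * n)})].
have indT : indep (map proj tp).
  move=> c; rewrite /lin_comb !size_map => e.
  apply: (@test_poly_indep F n T c uT iT); rewrite -proj_eq0 (linear_sum proj) -[X in _ == X]e.
  apply/eqP/eq_bigr => i _; rewrite (linearZ_LR proj) /= /tp -map_comp.
  by rewrite (nth_map (0, 0, false)%N).
have [r [rs indB spanB]] := indep_extend mons indT.
have span v : spanned (map proj (tp ++ r)) v.
  have -> : v = proj (repr v) by rewrite /proj reprK.
  rewrite [repr v]mpolyE (linear_sum proj).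
  elim/big_ind: _ => [|x y [c ->] [d ->]|m _].
  - by exists (fun=> 0); rewrite /lin_comb big1 // => i _; rewrite scale0r.
  - exists (fun i => c i + d i); rewrite /lin_comb -big_split.
    by apply: eq_bigr => i _; rewrite scalerDl.
  have [c ec] : spanned (map proj (tp ++ r)) (proj 'X_[m]).
    have [/existsP[k mk]|] := boolP [exists k, 2 * n <= m k]%N.
      have /eqP -> : proj 'X_[m] == 0 by rewrite proj_eq0 (monomial_in_coinv_ideal _ mk).
      by exists (fun=> 0); rewrite /lin_comb big1 // => i _; rewrite scale0r.
    rewrite negb_exists => /forallP sm; apply: spanB; apply: map_f.
    have lt k : (m k < 2 * n)%N by rewrite ltnNge.
    apply/mapP; exists [ffun k => Ordinal (lt k)]; first by rewrite mem_enum.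
    by apply/mnmP => k; rewrite mnmE ffunE.
  exists (fun i => (repr v)@_m * c i); rewrite (linearZ_LR proj) /= ec /lin_comb.
  by rewrite scaler_sumr; apply: eq_bigr => i _; rewrite scalerA.
rewrite (lmod_dimE (basis_vector_axiom indB span)) size_map size_cat addnC.
rewrite /tp size_map leq_add2l; apply: (@span_bound T r) => // p /rs /mapP[m _ ->].
by exists m.
Qed.

End LowerBound.

(** * Counting the test polynomials *)

Definition test_indexes (n : nat) : seq test_index :=
  [seq (A, j, false) | j <- iota 1 (n %/ 4), A <- iota 0 (n + 1 - 4 * j)] ++
  [seq (A, j, true) | j <- iota 0 ((n - 3) %/ 4), A <- iota 0 (n - 5 - 4 * j)].

Lemma test_indexes_uniq n : uniq (test_indexes n).
Proof.
rewrite cat_uniq; apply/and3P; split.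
- apply: allpairs_uniq_dep => [|j _|[j A] [j' A'] _ _ /= [-> ->]] //;
  exact: iota_uniq.
- apply/hasPn => t /allpairsPdep[j [A [_ _ ->]]].
  by apply/negP => /allpairsPdep[j' [A' [_ _ []]]].
- apply: allpairs_uniq_dep => [|j _|[j A] [j' A'] _ _ /= [-> ->]] //;
  exact: iota_uniq.
Qed.

Lemma test_indexes_valid n : all (valid_test n) (test_indexes n).
Proof.
apply/allP => t; rewrite mem_cat => /orP[] /allpairsPdep[j [A []]];
  rewrite !mem_iota => hj hA -> /=; lia.
Qed.

(** The closed form of sum_(1 <= j <= q) (n + 1 - 4j) + sum_(j < r) (n - 5 - 4j),
    written without subtractions. *)
Lemma size_test_indexes n q r : (n %/ 4 = q)%N -> ((n - 3) %/ 4 = r)%N ->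
  (size (test_indexes n) + 2 * (q * q) + 2 * q + 2 * (r * r) + 3 * r
   = q * n + q + r * n)%N.
Proof.
move=> eq er; rewrite size_cat !size_allpairs_dep !sumnE !big_map eq er.
under eq_bigr do rewrite size_iota.
under [X in (_ + X + _ + _ + _ + _)%N]eq_bigr do rewrite size_iota.
have e1 : (\sum_(j <- iota 1 q) (n + 1 - 4 * j) + 2 * (q * q) + 2 * q = q * n + q)%N.
  have : (4 * q <= n)%N by lia.
  elim: {eq} q => [|s IH] le; first by rewrite big_nil.
  have -> : iota 1 s.+1 = iota 1 s ++ [:: 1 + s]%N by rewrite -[s.+1]addn1 iotaD.
  by rewrite big_cat big_seq1 /=; have := IH (ltac:(lia)); nia.
have e2 : (\sum_(j <- iota 0 r) (n - 5 - 4 * j) + 2 * (r * r) + 3 * r = r * n)%N.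
  have : (r = 0 \/ 4 * r + 3 <= n)%N by lia.
  elim: {er} r => [_|s IH le]; first by rewrite big_nil.
  have -> : iota 0 s.+1 = rcons (iota 0 s) s by rewrite -cats1 -[s.+1]addn1 iotaD.
  rewrite -cats1 big_cat big_seq1 /=; have := IH (ltac:(lia)); nia.
lia.
Qed.

Lemma epsilon_ge (F : numFieldType) (n : nat) : (0 < n)%N ->
  (size (test_indexes n))%:Z <= epsilon F n.
Proof.
move=> n0; have := lmod_dim_coinv_ring F n0 (test_indexes_uniq n) (test_indexes_valid n).
by rewrite /epsilon; lia.
Qed.

Theorem theorem1p1 (R : realType) :
  (forall n : nat, (0 < n)%N ->
    let e : rat := (epsilon R[i] n)%:~R in
    [/\ (n = 0 %[mod 4])%N -> n%:R * (n%:R - 4) / 4 <= e,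
        (n = 2 %[mod 4])%N -> n%:R * (n%:R - 6) / 4 <= e
      & odd n -> (n%:R - 1) * (n%:R - 3) / 4 <= e])
  /\ 1 <= epsilon R[i] 4
  /\ 3 <= epsilon R[i] 6.
Proof.
split; last first.
  by split; apply: le_trans (epsilon_ge R[i] _).
move=> n n0 e.
have le : (size (test_indexes n))%:R <= e.
  by rewrite -[_%:R]/((size (test_indexes n))%:Z%:~R) ler_int; apply: epsilon_ge.
have bound q r : (n %/ 4)%N = q -> ((n - 3) %/ 4)%N = r ->
    q%:R * n%:R + q%:R + r%:R * n%:R - 2 * (q%:R * q%:R) - 2 * q%:R
    - 2 * (r%:R * r%:R) - 3 * r%:R <= e.
  move=> eq er; apply: le_trans le.
  have := congr1 (fun x : nat => x%:R : rat) (size_test_indexes eq er).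
  by rewrite /= !(natrD, natrM); lra.
split.
- move=> n4; have [p en] : exists p, (n = 4 * p.+1)%N by exists (n %/ 4).-1; lia.
  have := bound p.+1 p; rewrite en => h; apply: le_trans (h _ _); try by lia.
  by rewrite natrM -[p.+1%:R]natr1; lra.
- move=> n4; have [p en] : exists p, (n = 4 * p + 2)%N by exists (n %/ 4)%N; lia.
  case: p en => [|p] en.
    by have := bound 0%N 0%N; rewrite en => h; apply: le_trans (h erefl erefl); lra.
  have := bound p.+1 p; rewrite en => h; apply: le_trans (h _ _); try by lia.
  by have := ler0n rat p; rewrite natrD natrM -[p.+1%:R]natr1; lra.
- move=> on; have [p [en|en]] : exists p, (n = 4 * p + 1 \/ n = 4 * p + 3)%N.
    by exists (n %/ 4)%N; have := odd_double_half n; rewrite on; lia.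
    case: p en => [|p] en.
      by have := bound 0%N 0%N; rewrite en => h; apply: le_trans (h erefl erefl); lra.
    have := bound p.+1 p; rewrite en => h; apply: le_trans (h _ _); try by lia.
    by have := ler0n rat p; rewrite natrD natrM -[p.+1%:R]natr1; lra.
  have := bound p p; rewrite en => h; apply: le_trans (h _ _); try by lia.
  by rewrite natrD natrM; lra.
Qed.
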